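(* Let $Q$ be the generator of a uniformly ergodic Markov switching process with stationary distribution $\pi$ on $(E,\mathcal E)$, and let the family of kernels $\Gamma^{\delta}(dv;x)$, $x\in E$, $\delta>0$, together with the limit kernel $\Gamma^0(dv;x)$, satisfy the Lévy approximation conditions (approximation of mean values, asymptotic representation of the intensity kernel, balance condition), uniform square integrability and exponential finiteness, all as listed in the context. Consider the random evolution $$\xi^{\delta}_{\varepsilon}(t)=\xi^{\delta}_{\varepsilon}(0)+\int_0^t\eta^{\delta}_{\varepsilon}(ds;x(s/\varepsilon^3)),\quad t\ge 0,$$ with two-component generator $$\mathbb{L}^{\delta}_{\varepsilon}\Phi(u,x)=\varepsilon^{-3}Q\Phi(u,\cdot)(x)+\Gamma^{\delta}_{\varepsilon}(x)\Phi(\cdot,x)(u),\qquad \Gamma^{\delta}_{\varepsilon}(x)\psi(u)=\varepsilon^{-3}\int_{\mathbb{R}}[\psi(u+\varepsilon v)-\psi(u)]\,\Gamma^{\delta}(dv;x).$$ Then the exponential generators $$\mathbb{H}^{\varepsilon,\delta}\Phi:=e^{-\Phi/\varepsilon}\,\varepsilon\,\mathbb{L}^{\delta}_{\varepsilon}\,e^{\Phi/\varepsilon}$$ converge, as $\varepsilon,\delta\to0$ with $\varepsilon^{-1}\delta\to1$, to the exponential generator $$H^0\varphi(u)=(\widetilde a-\widetilde a_0)\varphi'(u)+\tfrac12\sigma^2(\varphi'(u))^2+\int_{\mathbb{R}}\big[e^{v\varphi'(u)}-1\big]\widetilde\Gamma^0(dv),$$ in the following sense: for every $\varphi\in C^3(\mathbb{R})$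 there exist functions $\varphi_1(u,x),\varphi_2(u,x)$, not depending on $\varepsilon,\delta$, such that for the perturbed test functions $$\varphi^{\delta}_{\varepsilon}(u,x)=\varphi(u)+\varepsilon\ln\big[1+\delta\varphi_1(u,x)+\delta^2\varphi_2(u,x)\big]$$ one has, for every $u\in\mathbb{R}$, $$\sup_{x\in E}\big|\mathbb{H}^{\varepsilon,\delta}\varphi^{\delta}_{\varepsilon}(u,x)-H^0\varphi(u)\big|\to0\quad\text{as }\varepsilon,\delta\to0,\ \varepsilon^{-1}\delta\to1.$$ Here $$\widetilde a=\int_E\pi(dx)a(x),\quad \widetilde a_0=\int_E\pi(dx)a_0(x),\quad a_0(x)=\int_{\mathbb{R}}v\,\Gamma^0(dv;x),$$ $$\widetilde c=\int_E\pi(dx)c(x),\quad \widetilde c_0=\int_E\pi(dx)c_0(x),\quad c_0(x)=\int_{\mathbb{R}}v^2\,\Gamma^0(dv;x),$$ $$\sigma^2=(\widetilde c-\widetilde c_0)+2\int_E\pi(dx)\,a_1(x)R_0a_1(x),\qquad \widetilde\Gamma^0(dv)=\int_E\pi(dx)\,\Gamma^0(dv;x).$$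
   Context: Switching process. $(E,\mathcal E)$ is a standard phase space and $\mathcal B_E$ is the Banach space of bounded real-valued measurable functions on $E$ with the sup norm. The Markov process $x(t)$, $t\ge0$, on $E$ has generator $Q\varphi(x)=q(x)\int_E[\varphi(y)-\varphi(x)]P(x,dy)$, where $q(x)\geq 0$ and $P(x,dy)$ is a stochastic kernel. It is uniformly ergodic with stationary distribution $\pi$. The operator $Q$ is reducible-invertible; $\Pi$ is the projector $\Pi\varphi=\int_E\pi(dx)\varphi(x)$ (times the constant function $1$) onto the null space of $Q$, so $Q\Pi=\Pi Q=0$; $R_0$ is the potential operator, satisfying $QR_0=R_0Q=\Pi-I$. Processes with independent increments. For $x\in E$, $\eta^{\delta}(t;x)$, $t\ge0$, is the real-valued Markov process with independent increments with generator $\varphi\mapsto\int_{\mathbb{R}}[\varphi(u+v)-\varphi(u)]\Gamma^{\delta}(dv;x)$, and $\eta^{\delta}_{\varepsilon}(t;x)=\varepsilon\,\eta^{\delta}(t/\varepsilon^3;x)$. The parameters $\varepsilon,\delta>0$ tend to $0$ with $\varepsilon^{-1}\delta\to1$. Assumptions on the kernels. (Approximation of mean values) $\int_{\mathbb{R}}v\,\Gamma^{\delta}(dv;x)=\delta a_1(x)+\delta^2[a(x)+\theta^{\delta}_a(x)]$ and $\int_{\mathbb{R}}v^2\,\Gamma^{\delta}(dv;x)=\delta^2[c(x)+\theta^{\delta}_c(x)]$, with $\sup_{x}|a_1(x)|<\infty$, $\sup_x|a(x)|<\infty$, $\sup_x|c(x)|<\infty$. (Asymptotic representation of the intensity kernel)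 For all $g\in C_3(\mathbb{R})$, $\int_{\mathbb{R}}g(v)\Gamma^{\delta}(dv;x)=\delta^2[\Gamma_g(x)+\theta^{\delta}_g(x)]$, where $|\Gamma_g(x)|\le\Gamma_g$ for a constant $\Gamma_g$ depending only on $g$, and the kernel $\Gamma^0(dv;x)$ is defined by $\Gamma_g(x)=\int_{\mathbb{R}}g(v)\Gamma^0(dv;x)$, $g\in C_3(\mathbb{R})$. Here $C_3(\mathbb{R})$ is the measure-determining class of bounded continuous functions $g:\mathbb{R}\to\mathbb{R}$ with $g(v)/v^2\to0$ as $v\to0$. The terms $\theta^{\delta}_a,\theta^{\delta}_c,\theta^{\delta}_g$ satisfy $\sup_{x\in E}|\theta^{\delta}_{\cdot}(x)|\to0$ as $\delta\to0$. (Balance condition) $\int_E\pi(dx)a_1(x)=0$. (Uniform square integrability) $\lim_{c\to\infty}\sup_{x\in E}\int_{|v|>c}v^2\,\Gamma^0(dv;x)=0$. (Exponential finiteness) $\int_{\mathbb{R}}e^{p|v|}\,\Gamma^{\delta}(dv;x)<\infty$ for all $p\in\mathbb{R}$. $C^3(\mathbb{R})$ denotes the space of continuous bounded functions on $\mathbb{R}$ with continuous bounded derivatives up to the third order.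
   Formalization: Exponential finiteness is strengthened: for each p, the integral of e^{p|v|} over |v|>1 against Γ^δ(dv;x) is at most Cδ² uniformly in x for small δ (the claim fails otherwise); v is also assumed integrable for Γ^0(dv;x) and the averaged kernel, so that a_0 and H^0 exist. *)

(* Defs.v *)
(* MathComp-Analysis, over an arbitrary real type R. *)
From HB Require Import structures.
From mathcomp Require Import all_boot all_order all_algebra.
From mathcomp Require Import all_classical all_reals all_analysis.
Set Implicit Arguments.
Unset Strict Implicit.
Unset Printing Implicit Defensive.
Import Order.TTheory GRing.Theory Num.Theory.
Import numFieldNormedType.Exports.
Local Open Scope classical_set_scope.
Local Open Scope ring_scope.

(* The sup norm, as an extended real: +oo exactly when f is unbounded. *)
Definition supnorm (R : realType) (T : Type) (f : T -> R) : \bar R :=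
  ereal_sup [set `|f x|%:E | x in [set: T]].

(* The limit "eps, delta -> 0 with eps^-1 delta -> 1", over pairs
   (eps, delta) of positive parameters. *)
Definition levy_scaling (R : realType) : set_system (R * R) :=
  [set A | exists2 r : R, 0 < r &
    forall eps delta : R, 0 < eps < r -> 0 < delta < r ->
      `|eps^-1 * delta - 1| < r -> A (eps, delta)].
Arguments levy_scaling : clear implicits.

Lemma levy_scaling_filter (R : realType) : ProperFilter (levy_scaling R).
Proof.
apply: Build_ProperFilter_ex.
  move=> A [r r0 Ar]; exists (r / 2, r / 2); apply: Ar.
  - by rewrite divr_gt0//= ltr_pdivrMr// ltr_pMr// ltr1n.
  - by rewrite divr_gt0//= ltr_pdivrMr// ltr_pMr// ltr1n.
  - by rewrite mulVf ?subrr ?normr0// gt_eqF// divr_gt0.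
split.
- by exists 1.
- move=> A B [r r0 Ar] [s s0 Bs]; exists (Num.min r s).
    by rewrite lt_min r0.
  move=> e d; rewrite !lt_min => /and3P[e0 er es] /and3P[d0 dr ds] /andP[kr ks].
  by split; [apply: Ar|apply: Bs]; rewrite ?e0 ?d0.
- move=> A B AB [r r0 Ar]; exists r => // e d er dr k.
  exact/AB/Ar.
Qed.
#[global] Existing Instance levy_scaling_filter.

(* The Banach space B_E, as a subset of all functions E -> R. *)
Definition bounded_measurable (R : realType) d (E : measurableType d) :
    set (E -> R) :=
  [set f : E -> R | measurable_fun [set: E] f /\
                    exists M : R, forall x, `|f x| <= M].

(* Standard Borel: isomorphic to the Borel space of a Polish space. *)
Definition standard_space (R : realType) d (E : measurableType d) : Prop :=
  exists (T : completePseudoMetricType R) (f : E -> T),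
    [/\ hausdorff_space T, @second_countable T, bijective f &
        forall A : set E, measurable A <-> <<s @open T >> (f @` A)].

Section switching.
Context (R : realType) (d : measure_display) (E : measurableType d).
Implicit Types (q : E -> R) (P : R.-pker E ~> E) (Pt : R -> R.-pker E ~> E).
Implicit Types (pi : probability E R).

Definition switchQ q P (f : E -> R) : E -> R :=
  fun x => q x * (\int[P x]_y (f y - f x)).

(* The domain of switchQ in B_E; it is all of B_E when q is bounded. *)
Definition switch_dom q P : set (E -> R) :=
  [set f : E -> R | bounded_measurable f /\ bounded_measurable (switchQ q P f)].

(* Pt t x is the law of x(t) given x(0) = x; only t >= 0 matters. *)
Definition transition_function Pt : Prop :=
  (forall x (A : set E), measurable A -> Pt 0 x A = \d_x A) /\
  (forall s t x (A : set E), 0 <= s -> 0 <= t -> measurable A ->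
     Pt (s + t) x A = (\int[Pt s x]_y Pt t y A)%E).

(* The derivative at 0 is taken pointwise on E, which makes sense for a
   possibly unbounded intensity q; for bounded q the semigroup is exp(tQ) and
   the limit is then automatically in the sup norm. *)
Definition has_generator Pt (Q : (E -> R) -> E -> R) : Prop :=
  forall f, bounded_measurable f -> forall x,
    t^-1 * ((\int[Pt t x]_y f y) - f x) @[t --> (0 : R)^'+] --> Q f x.

Definition stationary Pt pi : Prop :=
  forall t (A : set E), 0 <= t -> measurable A ->
    (\int[pi]_x Pt t x A)%E = pi A.

(* Convergence of the semigroup to the stationary projector in the operator
   norm of B_E. *)
Definition uniformly_ergodic Pt pi : Prop :=
  ereal_sup [set supnorm (fun x => (\int[Pt t x]_y f y) - \int[pi]_y f y) |
    f in [set f : E -> R | measurable_fun [set: E] f /\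
                           forall x, `|f x| <= 1]]
    @[t --> (+oo)%R] --> 0%E.

(* The scalar value of the projector; the projector itself is the constant
   function cst (Pi pi f). *)
Definition Pi pi (f : E -> R) : R := \int[pi]_x f x.

Definition reducible_invertible (q : E -> R) P : Prop :=
  (forall f, bounded_measurable f -> exists f0 g : E -> R,
     [/\ bounded_measurable f0, switchQ q P f0 = cst 0, switch_dom q P g &
         f = f0 \+ switchQ q P g]) /\
  (forall g, switch_dom q P g -> switchQ q P (switchQ q P g) = cst 0 ->
     switchQ q P g = cst 0).

Definition null_projector q P pi : Prop :=
  [/\ forall f, bounded_measurable f ->
        (switchQ q P f = cst 0 <-> f = cst (Pi pi f)),
      forall f, bounded_measurable f -> switchQ q P (cst (Pi pi f)) = cst 0 &
      forall f, switch_dom q P f -> Pi pi (switchQ q P f) = 0].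

(* R0 is a bounded linear operator on B_E with Q R0 = R0 Q = Pi - I. *)
Definition potential q P pi (R0 : (E -> R) -> E -> R) : Prop :=
  [/\ forall f, bounded_measurable f -> bounded_measurable (R0 f),
      forall (k : R) f g, bounded_measurable f -> bounded_measurable g ->
        R0 (fun x => k * f x + g x) = (fun x => k * R0 f x + R0 g x),
      exists C : R, forall f, bounded_measurable f ->
        (supnorm (R0 f) <= C%:E * supnorm f)%E,
      forall f, bounded_measurable f ->
        switchQ q P (R0 f) = (fun x => Pi pi f - f x) &
      forall f, switch_dom q P f ->
        R0 (switchQ q P f) = (fun x => Pi pi f - f x)].

Record ergodic_switching q P Pt pi (R0 : (E -> R) -> E -> R) : Prop := {
  switching_standard : standard_space R E ;
  intensity_measurable : measurable_fun [set: E] q ;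
  intensity_ge0 : forall x, 0 <= q x ;
  switching_markov : transition_function Pt ;
  switching_generator : has_generator Pt (switchQ q P) ;
  switching_stationary : stationary Pt pi ;
  switching_ergodic : uniformly_ergodic Pt pi ;
  switching_reducible : reducible_invertible q P ;
  switching_projector : null_projector q P pi ;
  switching_potential : potential q P pi R0 }.

End switching.

(* The class C_3(R), not to be confused with the smooth class below. Since g
   is continuous, the last condition forces g 0 = 0. *)
Definition C_3 (R : realType) : set (R -> R) :=
  [set g : R -> R | [/\ continuous g, exists M : R, forall v, `|g v| <= M &
               g v / v ^+ 2 @[v --> (0 : R)^'] --> (0 : R)]].

Definition C3_smooth (R : realType) : set (R -> R) :=
  [set f : R -> R |
     (forall n, (n < 3)%N -> forall u, derivable (derive1n n f) u 1) /\
           (forall n, (n <= 3)%N -> continuous (derive1n n f) /\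
              exists M : R, forall u, `|derive1n n f u| <= M)].

(* The measure A |-> \int pi(dx) K(x, A). *)
Section mixture.
Context (R : realType) (d d' : measure_display).
Context (E : measurableType d) (Y : measurableType d').
Variables (pi : probability E R) (K : R.-ker E ~> Y).
Local Open Scope ereal_scope.

Definition mixture (A : set Y) : \bar R := \int[pi]_x K x A.

Let mixture0 : mixture set0 = 0.
Proof.
by rewrite /mixture (eq_integral (cst 0)) ?integral0// => x _; rewrite measure0.
Qed.

Let mixture_ge0 A : 0 <= mixture A. Proof. exact: integral_ge0. Qed.

Let mixture_sigma_additive : semi_sigma_additive mixture.
Proof.
move=> U mU tU mUU; rewrite [X in _ --> X](_ : _ =
  \int[pi]_x (\sum_(n <oo) K x (U n))); last first.
  apply: eq_integral => V _.
  by apply/esym/cvg_lim => //; exact/measure_semi_sigma_additive.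
apply/cvg_closeP; split.
  by apply: is_cvg_nneseries => n _ _; exact: integral_ge0.
rewrite closeE// integral_nneseries// => n.
exact: measurable_kernel (mU n).
Qed.

HB.instance Definition _ := isMeasure.Build _ _ R
  mixture mixture0 mixture_ge0 mixture_sigma_additive.

End mixture.

Section levy_approximation.
Context (R : realType) (d : measure_display) (E : measurableType d).
(* Only the kernels Gam delta with delta > 0 matter. *)
Variables (Gam : R -> R.-ker E ~> R) (Gam0 : R.-ker E ~> R).
Variables (pi : probability E R) (R0 : (E -> R) -> E -> R).
Variables (a1 a c : E -> R) (q : E -> R) (P : R.-pker E ~> E).

Definition negligible_term (theta : R -> E -> R) : Prop :=
  supnorm (theta delta) @[delta --> (0 : R)^'+] --> 0%E.

Definition mean_approximation : Prop :=
  [/\ bounded_measurable a1, bounded_measurable a, bounded_measurable c &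
    exists theta_a theta_c : R -> E -> R,
    [/\ negligible_term theta_a, negligible_term theta_c &
      forall delta x, 0 < delta ->
        \int[Gam delta x]_v v =
          delta * a1 x + delta ^+ 2 * (a x + theta_a delta x) /\
        \int[Gam delta x]_v (v ^+ 2) =
          delta ^+ 2 * (c x + theta_c delta x)]].

(* Integrability against Gam0 is explicit because Rintegral is total. *)
Definition intensity_representation : Prop :=
  forall g : R -> R, C_3 g ->
    [/\ forall x, (Gam0 x).-integrable [set: R] (EFin \o g),
        exists M : R, forall x, `|\int[Gam0 x]_v g v| <= M &
        exists2 theta_g : R -> E -> R, negligible_term theta_g &
          forall delta x, 0 < delta ->
            \int[Gam delta x]_v g v =
              delta ^+ 2 * ((\int[Gam0 x]_v g v) + theta_g delta x)].

Definition balance : Prop := \int[pi]_x a1 x = 0.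

Definition uniform_square_integrability : Prop :=
  ereal_sup [set (\int[Gam0 x]_(v in [set v : R | (r < `|v|)%R]) (v ^+ 2)%:E)%E |
             x in [set: E]] @[r --> (+oo)%R] --> 0%E.

Definition exponential_finiteness : Prop :=
  forall delta p x, 0 < delta ->
    (\int[Gam delta x]_v (expR (p * `|v|))%:E < +oo)%E.

(* Exponential finiteness of the large jumps, uniformly in x and at the rate
   delta^2 of the intensity representation. Finiteness for each separate
   delta would not be enough: if E is a point and Gam delta is the mass
   delta^5 at 1/delta, all the other conditions hold with Gam0 = 0, and for
   eps = delta the jump part of the exponential generator is
   eps^3 (exp ((f (u + 1) - f u) / eps) (1 + o(1)) - 1), which
   diverges as soon as f (u + 1) > f u. *)
Definition uniform_exponential_finiteness : Prop :=
  forall p : R, exists C : R, \forall delta \near (0 : R)^'+, forall x,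
    (\int[Gam delta x]_(v in [set v : R | (1 < `|v|)%R]) (expR (p * `|v|))%:E
       <= (C * delta ^+ 2)%:E)%E.

(* The integrals of v defining a_0 and its average are absolutely convergent;
   the second condition also makes the integral in H^0 converge near 0. *)
Definition first_moment_limit : Prop :=
  (forall x, (Gam0 x).-integrable [set: R] (EFin \o id)) /\
  (mixture pi Gam0).-integrable [set: R] (EFin \o id).

Definition a_0 (x : E) : R := \int[Gam0 x]_v v.

Definition c_0 (x : E) : R := \int[Gam0 x]_v (v ^+ 2).

Definition sigma2 : R :=
  ((\int[pi]_x c x) - \int[pi]_x c_0 x) +
  2 * \int[pi]_x (a1 x * R0 a1 x).

Definition H0 (phi : R -> R) (u : R) : R :=
  ((\int[pi]_x a x) - \int[pi]_x a_0 x) * derive1 phi u +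
  2^-1 * sigma2 * derive1 phi u ^+ 2 +
  \int[mixture pi Gam0]_v (expR (v * derive1 phi u) - 1).

Definition jump_generator (eps delta : R) (x : E) (psi : R -> R)
    (u : R) : R :=
  eps ^- 3 * \int[Gam delta x]_v (psi (u + eps * v) - psi u).

Definition evolution_generator (eps delta : R) (Phi : R -> E -> R)
    (u : R) (x : E) : R :=
  eps ^- 3 * switchQ q P (Phi u) x +
  jump_generator eps delta x (Phi^~ x) u.

Definition exponential_generator (eps delta : R) (Phi : R -> E -> R)
    (u : R) (x : E) : R :=
  expR (- Phi u x / eps) *
  (eps * evolution_generator eps delta
           (fun u' x' => expR (Phi u' x' / eps)) u x).

Definition perturbed (phi : R -> R) (phi1 phi2 : R -> E -> R) (eps delta : R)
    (u : R) (x : E) : R :=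
  phi u + eps * ln (1 + delta * phi1 u x + delta ^+ 2 * phi2 u x).

(* Bounded and separately measurable: then, for small delta, the logarithm in
   perturbed has a positive argument and both integrals in
   evolution_generator are those of bounded measurable functions. *)
Definition admissible_perturbation (f : R -> E -> R) : Prop :=
  [/\ exists M : R, forall u x, `|f u x| <= M,
      forall u, measurable_fun [set: E] (f u) &
      forall x, measurable_fun [set: R] (f^~ x)].

End levy_approximation.

(* Main.v *)
Require Import Defs.
From HB Require Import structures.
From mathcomp Require Import all_boot all_order all_algebra.
From mathcomp Require Import all_classical all_reals all_analysis.
From mathcomp Require Import measurable_realfun ring lra.
Set Implicit Arguments.
Unset Strict Implicit.
Unset Printing Implicit Defensive.
Import Order.TTheory GRing.Theory Num.Theory.
Import numFieldNormedType.Exports.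
Local Open Scope classical_set_scope.
Local Open Scope ring_scope.

(** Put [W = 1 + delta * phi1 + delta ^+ 2 * phi2] and let [s] be the slope
    [derive1 phi u]. On the perturbed test function the exponential generator
    equals
      [eps ^- 2 * W^-1 * (delta * Q phi1 + delta ^+ 2 * Q phi2 + J)],
    where [J] integrates
      [expR ((phi (u + eps * v) - phi u) / eps) * W (u + eps * v) - W u]
    against the intensity kernel ([exponential_generatorE]).

    Expanding this integrand to second order in [v], with the higher-order part
    of [expR (v * s)] kept apart, leaves a remainder of the order of
    [(eps + delta) * v ^+ 2 * expR (K * `|v|)]; the integral of this weight is
    of the order of [delta ^+ 2], by the second moment for small jumps and by
    uniform exponential finiteness for large ones ([Gam_qexp_le]). It is
    essential to expand in powers of [v] rather than of [`|v|]: the moments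
    known for the kernels are those of [v] and [v ^+ 2], while the integral of
    [`|v|] may be large. Hence both correctors have to be of class C^{1,1} in
    [u], uniformly in [x] ([unif_C11]), and
      [J = delta * s * a1 + delta ^+ 2 * A + o(delta ^+ 2)],
      [A = s * a + s ^+ 2 / 2 * c + s * a1 * phi1 + G s],
    with [G s] the integral of [expR (v * s) - 1 - v * s - (v * s) ^+ 2 / 2]
    against the limit kernel. This integrand is o(v^2) at the origin but
    unbounded, so that the asymptotic representation of the kernels has to be
    extended to functions of exponential growth ([Gam_cvg_exp_growth]).

    The correctors remove the oscillation in [x]: [phi1 = s * R0 a1] satisfies
    [Q phi1 = - s * a1] by the balance condition, and [phi2 = R0 A] satisfies
    [Q phi2 = Pi A - A]. The bracket is then [delta ^+ 2 * (Pi A + o(1))]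
    ([bracket_estimate]), uniformly in [x]; since [delta / eps] and [W] tend to
    [1], the limit is [Pi A] ([ratio_estimate]). Finally [Pi A] is the limit
    generator by Fubini for the averaged kernel ([Pi_symbol]). The regularity
    of [phi2] in [u] follows from that of [s |-> A] in the sup norm, because
    the potential [R0] is linear and bounded ([potential_expansion]). *)

(** * Exponential inequalities *)

Section exponential_bounds.
Context (R : realType).
Implicit Types x y v p q s t : R.

Lemma le_normB_expR x y (K : R) : `|x| <= K -> `|y| <= K ->
  `|expR x - expR y| <= `|x - y| * expR K.
Proof.
wlog xy : x y / x <= y.
  move=> h xK yK; case: (leP x y) => [xy|/ltW yx]; first exact: h.
  by rewrite distrC (distrC x); exact: h.
move=> xK yK; rewrite distrC (distrC x) !ger0_norm ?subr_ge0 ?ler_expR//.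
have -> : expR y - expR x = (1 - expR (x - y)) * expR y.
  by rewrite mulrBl mul1r -expRD subrK.
apply: ler_pM; rewrite ?subr_ge0 ?expR_ge0//.
- by rewrite -[leRHS]expR0 ler_expR subr_le0.
- by rewrite lerBlDr -lerBlDl opprB addrC; have := expR_ge1Dx (x - y); lra.
- by rewrite ler_expR (le_trans (ler_norm y)).
Qed.

Lemma expR_taylor1 y : `|expR y - 1 - y| <= y ^+ 2 * expR `|y|.
Proof.
have h1 := expR_ge1Dx y; have h2 := expR_ge1Dx (- y).
have e0 := expR_gt0 y.
rewrite ger0_norm; last lra.
have hu : expR y * (1 - y) <= 1.
  rewrite -ler_pdivlMl// -expRN mulr1; lra.
have h3 : expR y - 1 - y <= y * (expR y - 1) by nra.
apply: le_trans h3 _; have [y0|y0] := leP 0 y.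
  rewrite expr2 -mulrA ger0_norm//; apply: ler_wpM2l => //; nra.
have e1 : 1 <= expR `|y| by rewrite -[leLHS]expR0 ler_expR.
nra.
Qed.

Lemma expR_taylor2 y :
  `|expR y - 1 - y - y ^+ 2 / 2| <= `|y| ^+ 3 * expR `|y|.
Proof.
pose f (z : R) := expR z - 1 - z - z ^+ 2 / 2.
have fE (z : R) : is_derive z 1 f (expR z - 1 - z).
  rewrite /f; apply: is_derive_eq.
  by rewrite /GRing.scale/=; field.
have fc : continuous f.
  by move=> z; apply/differentiable_continuous/derivable1_diffP; case: (fE z).
have key : exists2 c, `|c| <= `|y| & f y = (expR c - 1 - c) * y.
  have f0 : f 0 = 0 by rewrite /f expR0; field.
  have [y0|/ltW y0] := leP 0 y.
    have [c cy] := MVT_segment y0 (fun z _ => fE z) (continuous_subspaceT fc).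
    rewrite f0 !subr0 => ->; exists c => //.
    by move: cy; rewrite in_itv/= => /andP[c0 cy]; rewrite !ger0_norm.
  have [c cy] := MVT_segment y0 (fun z _ => fE z) (continuous_subspaceT fc).
  rewrite f0 !sub0r => /eqP; rewrite mulrN eqr_opp => /eqP ->; exists c => //.
  by move: cy; rewrite in_itv/= => /andP[c0 cy]; rewrite !ler0_norm// lerN2.
have [c cy] := key; rewrite /f => ->; rewrite normrM [in leRHS]exprS mulrC -mulrA.
apply: ler_wpM2l => //; apply: le_trans (expR_taylor1 c) _.
rewrite -real_normK ?num_real//; apply: ler_pM; rewrite ?exprn_ge0 ?expR_ge0//.
  by rewrite lerXn2r ?nnegrE.
by rewrite ler_expR.
Qed.

Lemma le_norm_expR v : `|v| <= expR `|v|.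
Proof. by have := expR_ge1Dx `|v|; lra. Qed.

(** The weight that dominates all the remainders: quadratic near the origin,
    exponential at infinity. *)
Definition qexp p v : R := v ^+ 2 * expR (p * `|v|).

Lemma qexp_ge0 p v : 0 <= qexp p v.
Proof. by rewrite mulr_ge0 ?sqr_ge0 ?expR_ge0. Qed.

Lemma sqr_le_qexp p v : 0 <= p -> v ^+ 2 <= qexp p v.
Proof. by move=> p0; rewrite ler_peMr ?sqr_ge0// -expR0 ler_expR mulr_ge0. Qed.

Lemma cube_le_qexp p v : `|v| ^+ 3 * expR (p * `|v|) <= qexp (p + 1) v.
Proof.
rewrite /qexp mulrDl mul1r expRD -(@real_normK _ v) ?num_real//.
rewrite (exprSr _ 2) -mulrA ler_wpM2l ?exprn_ge0// [leLHS]mulrC.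
by rewrite ler_wpM2l ?expR_ge0 ?le_norm_expR.
Qed.

Lemma qexp_le_expR p v : qexp p v <= expR ((p + 2) * `|v|).
Proof.
rewrite /qexp mulrDl addrC expRD ler_wpM2r ?expR_ge0//.
rewrite -(@real_normK _ v) ?num_real// mulrDl mul1r expRD expr2.
by rewrite ler_pM ?le_norm_expR.
Qed.

Lemma continuous_qexp p : continuous (qexp p).
Proof.
move=> v; apply: cvgM; first exact: exprn_continuous.
apply: continuous_comp; last exact: continuous_expR.
by apply: cvgMr; exact: norm_continuous.
Qed.

(** A damping factor which vanishes at the origin and, for positive [q], decays
    exponentially at infinity; away from the origin it increases to [1] as
    [eta] decreases to [0]. *)
Definition damp (eta q v : R) : R := `|v| / (`|v| + eta * expR (q * `|v|)).

Section damp.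
Variables (eta q : R).
Hypothesis eta0 : 0 < eta.

Lemma damp_den_gt0 v : 0 < `|v| + eta * expR (q * `|v|).
Proof. by rewrite ltr_wpDl// mulr_gt0 ?expR_gt0. Qed.

Lemma damp_ge0 v : 0 <= damp eta q v.
Proof. by rewrite divr_ge0// ltW// damp_den_gt0. Qed.

Lemma damp_le1 v : damp eta q v <= 1.
Proof.
rewrite ler_pdivrMr ?damp_den_gt0// mul1r lerDl.
by rewrite mulr_ge0 ?expR_ge0// ltW.
Qed.

Lemma continuous_damp : continuous (damp eta q).
Proof.
move=> v; apply: cvgM; first exact: norm_continuous.
apply: cvgV; first by rewrite gt_eqF// damp_den_gt0.
apply: cvgD; first exact: norm_continuous.
apply: cvgMr; apply: continuous_comp; last exact: continuous_expR.
by apply: cvgMr; exact: norm_continuous.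
Qed.

Lemma damp_le v : damp eta q v <= eta^-1 * (`|v| * expR (- q * `|v|)).
Proof.
rewrite ler_pdivrMr ?damp_den_gt0// mulrDr.
have -> : eta^-1 * (`|v| * expR (- q * `|v|)) * (eta * expR (q * `|v|)) = `|v|.
  rewrite mulrACA mulVf ?gt_eqF// mul1r -mulrA mulNr -expRD.
  by rewrite [- _ + _]addrC subrr expR0 mulr1 .
by rewrite lerDr !mulr_ge0 ?expR_ge0// invr_ge0 ltW.
Qed.

(** The damping changes a cubic function by at most [eta] times the weight. *)
Lemma cube_undamp_le v :
  `|v| ^+ 3 * (1 - damp eta q v) <= eta * qexp q v.
Proof.
have d0 := damp_den_gt0 v.
have -> : 1 - damp eta q v =
    eta * expR (q * `|v|) / (`|v| + eta * expR (q * `|v|)).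
  by rewrite /damp; field; rewrite gt_eqF.
rewrite mulrA ler_pdivrMr// /qexp -(@real_normK _ v) ?num_real//.
set e := expR _; have e0 : 0 < e by exact: expR_gt0.
have v0 := normr_ge0 v; set r := `|v| in v0 *.
rewrite -subr_ge0.
have -> : eta * (r ^+ 2 * e) * (r + eta * e) - r ^+ 3 * (eta * e) =
  (eta * e * r) ^+ 2 by ring.
exact: sqr_ge0.
Qed.

End damp.

(** Damping brings a continuous function dominated by the weight into the class
    on which the intensity kernels have an asymptotic representation. *)
Lemma C_3_damp (f : R -> R) (C p eta : R) : 0 < eta -> continuous f ->
  (forall v, `|f v| <= C * qexp p v) ->
  C_3 (fun v => f v * damp eta (p + 3) v).
Proof.
move=> eta0 fc fC.
have C0 : 0 <= C.
  have := fC 1; rewrite /qexp expr1n mul1r => /(le_trans (normr_ge0 _)).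
  by rewrite pmulr_lge0 ?expR_gt0.
split.
- by move=> v; apply: cvgM; [exact: fc|exact: continuous_damp].
- exists (C * eta^-1) => v; rewrite normrM (ger0_norm (damp_ge0 _ eta0 _)) //.
  apply: le_trans (ler_pM _ _ (fC v) (damp_le _ eta0 _)) _; rewrite ?damp_ge0//.
  rewrite mulrACA ler_piMr ?mulr_ge0 ?invr_ge0 ?(ltW eta0)//.
  apply: (@le_trans _ _
    (expR ((p + 2) * `|v|) * (expR `|v| * expR (- (p + 3) * `|v|)))).
    apply: ler_pM; rewrite ?qexp_ge0 ?qexp_le_expR ?mulr_ge0 ?expR_ge0//.
    by rewrite ler_wpM2r ?expR_ge0 ?le_norm_expR.
  by rewrite -!expRD -[leRHS]expR0 ler_expR; lra.
- apply/cvgr0Pnorm_le => e e0.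
  have hc : continuous (fun v => C * expR (p * `|v|) * damp eta (p + 3) v).
    move=> v; apply: cvgM; last exact: continuous_damp.
    apply: cvgMr; apply: continuous_comp; last exact: continuous_expR.
    by apply: cvgMr; exact: norm_continuous.
  have {hc} := hc 0; rewrite /continuous_at {2}/damp normr0 mul0r mulr0.
  move/cvgr0Pnorm_le => /(_ e e0) /nbhs_dnbhs h.
  near=> v.
  have v0 : v != 0 by near: v; exact: nbhs_dnbhs_neq.
  have : `|C * expR (p * `|v|) * damp eta (p + 3) v| <= e.
    by near: v.
  apply: le_trans; rewrite mulrAC normrM [leRHS]normrM ler_wpM2r//.
  rewrite normf_div (ger0_norm (sqr_ge0 v)) ler_pdivrMr ?exprn_even_gt0//.
  rewrite ger0_norm ?mulr_ge0 ?expR_ge0//; have := fC v; rewrite /qexp; lra.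
Unshelve. all: by end_near. Qed.

End exponential_bounds.

(** * Taylor expansions of test functions and of the jump integrand *)

Section smooth.
Context (R : realType).
Implicit Types (f : R -> R) (M x y u h : R).

Lemma le_normB_derive1 f M : (forall x, derivable f x 1) ->
  (forall x, `|derive1 f x| <= M) ->
  forall x y, `|f y - f x| <= M * `|y - x|.
Proof.
move=> df dfM x y; wlog xy : x y / x <= y.
  move=> hw; case: (leP x y) => [|/ltW] xy; first exact: hw.
  by rewrite distrC (distrC y); exact: hw.
have fE (z : R) : is_derive z 1 f (derive1 f z).
  by rewrite derive1E; exact/derivableP.
have fc : continuous f.
  by move=> z; apply/differentiable_continuous/derivable1_diffP; exact: df.
have [c _ ->] := MVT_segment xy (fun z _ => fE z) (continuous_subspaceT fc).
by rewrite normrM ler_wpM2r.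
Qed.

Lemma taylor1_derive1 f M : (forall x, derivable f x 1) ->
  (forall x, derivable (derive1 f) x 1) ->
  (forall x, `|derive1 (derive1 f) x| <= M) ->
  forall u h, `|f (u + h) - f u - h * derive1 f u| <= M * h ^+ 2.
Proof.
move=> df ddf ddfM u h.
have fE (z : R) : is_derive z 1 f (derive1 f z).
  by rewrite derive1E; exact/derivableP.
have fc : continuous f.
  by move=> z; apply/differentiable_continuous/derivable1_diffP; exact: df.
have M0 : 0 <= M by exact: le_trans (ddfM 0).
have [c cu ->] : exists2 c, `|c - u| <= `|h| & f (u + h) - f u = h * derive1 f c.
  have [h0|/ltW h0] := leP 0 h.
    have uh : u <= u + h by lra.
    have [c cu E] := MVT_segment uh (fun z _ => fE z) (continuous_subspaceT fc).
    exists c; last by rewrite E; ring.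
    move: cu; rewrite in_itv/= => /andP[c1 c2].
    by rewrite !ger0_norm; lra.
  have uh : u + h <= u by lra.
  have [c cu E] := MVT_segment uh (fun z _ => fE z) (continuous_subspaceT fc).
  exists c; last by rewrite -opprB E; ring.
  move: cu; rewrite in_itv/= => /andP[c1 c2].
  by rewrite !ler0_norm; lra.
rewrite -mulrBr normrM -(@real_normK _ h) ?num_real// expr2 mulrCA ler_wpM2l//.
apply: le_trans (le_normB_derive1 ddf ddfM _ _) _.
by rewrite ler_wpM2l.
Qed.

End smooth.

Section levy_remainder.
Context (R : realType).
Implicit Types (s t v K : R).

(** The integrand of the compensated exponent, and its derivative in [s]. *)
Definition levy_rem s v : R := expR (v * s) - 1 - v * s - (v * s) ^+ 2 / 2.

Definition levy_rem_deriv s v : R := v * (expR (v * s) - 1 - v * s).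

Lemma continuous_expR_affine s : continuous (fun v : R => expR (v * s)).
Proof.
move=> v; apply: continuous_comp; last exact: continuous_expR.
exact: mulrr_continuous.
Qed.

Lemma continuous_levy_rem s : continuous (levy_rem s).
Proof.
have m : continuous (fun v : R => v * s) by exact: mulrr_continuous.
move=> v; apply: cvgB; first (apply: cvgB; first apply: cvgB).
- exact: continuous_expR_affine.
- exact: cvg_cst.
- exact: m.
apply: cvgMl; exact: (continuous_comp (m v) (@exprn_continuous R 2 _)).
Qed.

Lemma continuous_levy_rem_deriv s : continuous (levy_rem_deriv s).
Proof.
move=> v; apply: cvgM => //; apply: cvgB; first apply: cvgB.
- exact: continuous_expR_affine.
- exact: cvg_cst.
- exact: mulrr_continuous.
Qed.

Lemma normM_le_expR K s v : `|s| <= K -> expR `|v * s| <= expR (K * `|v|).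
Proof. by move=> sK; rewrite ler_expR normrM mulrC ler_wpM2r. Qed.

Lemma norm_levy_rem_le K s v : `|s| <= K ->
  `|levy_rem s v| <= K ^+ 3 * (`|v| ^+ 3 * expR (K * `|v|)).
Proof.
move=> sK; apply: le_trans (expR_taylor2 _) _.
rewrite mulrA; apply: ler_pM; rewrite ?exprn_ge0 ?expR_ge0//.
  rewrite normrM exprMn mulrC ler_wpM2r ?exprn_ge0//.
  by rewrite lerXn2r ?nnegrE// (le_trans _ sK).
exact: normM_le_expR.
Qed.

Lemma norm_levy_rem_deriv_le K s v : `|s| <= K ->
  `|levy_rem_deriv s v| <= K ^+ 2 * (`|v| ^+ 3 * expR (K * `|v|)).
Proof.
move=> sK; rewrite /levy_rem_deriv normrM.
have -> : K ^+ 2 * (`|v| ^+ 3 * expR (K * `|v|)) =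
  `|v| * ((K ^+ 2 * `|v| ^+ 2) * expR (K * `|v|)) by ring.
apply: ler_wpM2l => //; apply: le_trans (expR_taylor1 _) _.
apply: ler_pM; rewrite ?sqr_ge0 ?expR_ge0 ?normM_le_expR//.
rewrite exprMn mulrC -(@real_normK _ v) ?num_real// -(@real_normK _ s) ?num_real//.
by rewrite ler_wpM2r ?exprn_ge0// lerXn2r ?nnegrE// (le_trans _ sK).
Qed.

Lemma levy_rem_expansion K s t v : `|s| <= K -> `|t| <= K ->
  `|levy_rem t v - levy_rem s v - (t - s) * levy_rem_deriv s v|
    <= 2 * (t - s) ^+ 2 * qexp (3 * K) v.
Proof.
move=> sK tK; set h := t - s.
have K0 : 0 <= K by exact: le_trans sK.
have -> : levy_rem t v - levy_rem s v - h * levy_rem_deriv s v =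
    expR (v * s) * (expR (v * h) - 1 - v * h) - (v * h) ^+ 2 / 2.
  have -> : levy_rem t v = expR (v * s) * expR (v * h) - 1 - v * t - (v * t) ^+ 2 / 2.
    by rewrite /levy_rem -expRD -mulrDr (_ : s + h = t)// /h; ring.
  by rewrite /levy_rem /levy_rem_deriv /h; field.
(* the exponents K of expR (v * s) and 2 * K of expR (v * h) add up to 3 * K *)
have hK : `|h| <= 2 * K.
  by apply: le_trans (ler_normB _ _) _; lra.
have -> : 2 * h ^+ 2 * qexp (3 * K) v =
    h ^+ 2 * qexp (3 * K) v + h ^+ 2 * qexp (3 * K) v.
  by ring.
apply: le_trans (ler_normB _ _) _; apply: lerD; last first.
  have : v ^+ 2 <= qexp (3 * K) v by apply: sqr_le_qexp; lra.
  have h2 := sqr_ge0 h; have v2 := sqr_ge0 v.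
  rewrite ger0_norm ?divr_ge0 ?sqr_ge0// exprMn; nra.
rewrite normrM (ger0_norm (expR_ge0 _)).
apply: (@le_trans _ _ (expR (K * `|v|) * ((v * h) ^+ 2 * expR ((2 * K) * `|v|)))).
  apply: ler_pM; rewrite ?expR_ge0//.
    by apply: le_trans (normM_le_expR v sK); rewrite ler_expR ler_norm.
  apply: le_trans (expR_taylor1 _) _.
  by rewrite ler_wpM2l ?sqr_ge0// normM_le_expR.
rewrite /qexp (_ : 3 * K * `|v| = K * `|v| + 2 * K * `|v|); last by ring.
by rewrite expRD le_eqVlt; apply/orP; left; apply/eqP; ring.
Qed.

End levy_remainder.

Section jump_expansion.
Context (R : realType).
Variables (K M eps s v D : R).
Hypotheses (K0 : 0 <= K) (eps_gt0 : 0 < eps) (eps_le1 : eps <= 1).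
Hypothesis sK : `|s| <= K.
Variable y : R.
Hypotheses (yK : `|y| <= K * `|v|) (ys : `|y - v * s| <= M * eps * v ^+ 2).

(** Here [y] stands for the rescaled increment of the test function at a jump of
    size [v], and [s] for its slope. *)
Lemma expR_jump_levy_rem :
  `|expR y - 1 - (v * s + (v * s) ^+ 2 / 2 + levy_rem s v)|
    <= M * eps * qexp K v.
Proof.
have -> : expR y - 1 - (v * s + (v * s) ^+ 2 / 2 + levy_rem s v) =
   expR y - expR (v * s) by rewrite /levy_rem; ring.
apply: (@le_trans _ _ (`|y - v * s| * expR (K * `|v|))).
  by apply: le_normB_expR => //; rewrite normrM mulrC ler_wpM2r.
by rewrite /qexp mulrA ler_wpM2r ?expR_ge0.
Qed.

(** The corresponding expansion, to first order in [v], for a factor which jumps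
    from [z0] to [z]. *)
Lemma expR_jump_mul (z0 z : R) : 0 <= M -> `|z| <= M ->
  `|z - z0| <= 2 * M * (eps * `|v|) ->
  `|z - z0 - eps * v * D| <= M * (eps * v) ^+ 2 ->
  `|expR y * z - z0 - v * (s * z0 + eps * D)|
    <= (M * (K ^+ 2 + M) + 2 * K * M + M) * qexp K v.
Proof.
move=> M0 zM zz zD.
have -> : expR y * z - z0 - v * (s * z0 + eps * D) =
  (expR y - 1 - v * s) * z + v * s * (z - z0) + (z - z0 - eps * v * D) by ring.
have vq := sqr_le_qexp v K0; have v2 := sqr_ge0 v.
have q0 := qexp_ge0 K v.
apply: le_trans (ler_normD _ _) _; rewrite [leRHS]mulrDl; apply: lerD; last first.
  apply: le_trans zD _; rewrite exprMn; apply: ler_wpM2l => //.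
  apply: le_trans vq; rewrite ler_piMl//.
  by rewrite exprn_ile1// ltW.
apply: le_trans (ler_normD _ _) _; rewrite [leRHS]mulrDl; apply: lerD.
  rewrite normrM mulrC -mulrA; apply: ler_pM => //.
  have -> : expR y - 1 - v * s = (expR y - 1 - y) + (y - v * s) by ring.
  apply: le_trans (ler_normD _ _) _; rewrite [leRHS]mulrDl; apply: lerD.
    apply: le_trans (expR_taylor1 _) _.
    rewrite /qexp mulrA; apply: ler_pM; rewrite ?sqr_ge0 ?expR_ge0 ?ler_expR//.
    rewrite -(@real_normK _ y) ?num_real// -(@real_normK _ v) ?num_real// -exprMn.
    by rewrite lerXn2r ?nnegrE ?mulr_ge0.
  apply: le_trans ys _; rewrite -mulrA ler_wpM2l//.
  by apply: le_trans vq; rewrite ler_piMl.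
rewrite !normrM.
apply: (@le_trans _ _ (`|v| * K * (2 * M * (eps * `|v|)))).
  by apply: ler_pM; rewrite ?mulr_ge0// ler_wpM2l.
have -> : `|v| * K * (2 * M * (eps * `|v|)) = 2 * K * M * (eps * `|v| ^+ 2).
  by ring.
rewrite real_normK ?num_real// ler_wpM2l ?mulr_ge0//.
by apply: le_trans vq; rewrite ler_piMl.
Qed.

End jump_expansion.

(** * The sup norm and weighted integrals *)

Section supnorm_theory.
Context (R : realType) (T : Type).
Implicit Types f : T -> R.

Lemma supnorm_ge f x : (`|f x|%:E <= supnorm f)%E.
Proof. by apply: ereal_sup_ubound; exists x. Qed.

Lemma supnorm_le f M : (forall x, `|f x| <= M) -> (supnorm f <= M%:E)%E.
Proof. by move=> fM; apply: ge_ereal_sup => _ [x _ <-]; rewrite lee_fin. Qed.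

(** A point [x0] is needed because the sup norm over an empty type is [-oo]. *)
Lemma supnorm_cvg0P (I : Type) (F : set_system I) (FF : Filter F)
    (g : I -> T -> R) (x0 : T) :
  supnorm (g i) @[i --> F] --> 0%E <->
  forall e, 0 < e -> \forall i \near F, forall x, `|g i x| <= e.
Proof.
split=> [g0 e e0|ge].
  have /g0 : nbhs (0%E : \bar R) [set y | (y < e%:E)%E].
    by apply: open_nbhs_nbhs; split; [exact: open_ereal_lt_ereal|rewrite /= lte_fin].
  apply: (@filterS _ F FF) => i /= /ltW ie x.
  by rewrite -lee_fin (le_trans (supnorm_ge _ _)).
have g0 i : (0 <= supnorm (g i))%E.
  by apply: (le_trans _ (supnorm_ge _ x0)); rewrite lee_fin.
apply/fine_cvgP; split.
  have := ge _ ltr01; apply: (@filterS _ F FF) => i gi.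
  by rewrite ge0_fin_numE// (le_lt_trans (supnorm_le gi))// ltry.
apply/cvgr0Pnorm_le => e e0; have := ge _ e0; apply: (@filterS _ F FF) => i gi.
rewrite /= ger0_norm ?fine_ge0// -lee_fin fineK ?supnorm_le//.
by rewrite ge0_fin_numE// (le_lt_trans (supnorm_le gi))// ltry.
Qed.

End supnorm_theory.

Section qexp_measure.
Context (R : realType) (mu : {measure set R -> \bar R}).
Implicit Types (f : R -> R) (C V p : R).

Lemma measurable_qexp p : measurable_fun [set: R] (qexp p).
Proof. by apply: continuous_measurable_fun; exact: continuous_qexp. Qed.

Lemma integrable_qexp V p : (\int[mu]_v (qexp p v)%:E <= V%:E)%E ->
  mu.-integrable [set: R] (EFin \o qexp p).
Proof.
move=> muV; apply/integrableP; split.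
  by apply/measurable_EFinP; exact: measurable_qexp.
under eq_integral do rewrite /= ger0_norm ?qexp_ge0//.
by rewrite (le_lt_trans muV)// ltry.
Qed.

Variables (V p : R).
Hypothesis muV : (\int[mu]_v (qexp p v)%:E <= V%:E)%E.

Lemma le_qexp_integrable f C : measurable_fun [set: R] f ->
  (forall v, `|f v| <= C * qexp p v) -> mu.-integrable [set: R] (EFin \o f).
Proof.
move=> mf fC; apply: (@le_integrable _ _ _ _ _ measurableT _
  (fun v => (C%:E * (qexp p v)%:E)%E)).
- exact/measurable_EFinP.
- by move=> v _; rewrite -EFinM /= lee_fin (le_trans (fC v))// ler_norm.
- exact: integrableZl (integrable_qexp muV).
Qed.

Lemma Rintegral_qexp_le : \int[mu]_v qexp p v <= V.
Proof.
have i := integrable_qexp muV.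
rewrite -lee_fin /Rintegral fineK//.
exact: (integrable_fin_num measurableT i).
Qed.

Lemma norm_Rintegral_qexp_le f C : 0 <= C -> measurable_fun [set: R] f ->
  (forall v, `|f v| <= C * qexp p v) -> `|\int[mu]_v f v| <= C * V.
Proof.
move=> C0 mf fC.
have fi := le_qexp_integrable mf fC.
have qi := integrable_qexp muV.
apply: le_trans (le_normr_Rintegral measurableT fi) _.
apply: (@le_trans _ _ (\int[mu]_v (C * qexp p v))); last first.
  by rewrite RintegralZl// ler_wpM2l// Rintegral_qexp_le.
apply: le_Rintegral => //; last first.
- exact: (integrableZl measurableT C qi).
- exact: (integrable_norm fi).
Qed.

End qexp_measure.

Section levy_moments.
Context (R : realType) (d : measure_display) (E : measurableType d).
Variables (Gam : R -> R.-ker E ~> R) (a1 a c : E -> R).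
Variable x0 : E.
Hypothesis hmean : mean_approximation Gam a1 a c.
Hypothesis hexp : exponential_finiteness Gam.
Hypothesis huexp : uniform_exponential_finiteness Gam.

Lemma negligible_termP (theta : R -> E -> R) : negligible_term theta ->
  forall e, 0 < e -> \forall delta \near (0 : R)^'+, forall x, `|theta delta x| <= e.
Proof.
by move=> h; exact/(supnorm_cvg0P _ theta x0).
Qed.

Lemma Gam_dominated_integrable delta x (f : R -> R) p : 0 < delta ->
  measurable_fun [set: R] f -> (forall v, `|f v| <= expR (p * `|v|)) ->
  (Gam delta x).-integrable [set: R] (EFin \o f).
Proof.
move=> d0 mf fe; apply/integrableP; split; first exact/measurable_EFinP.
apply: le_lt_trans (@hexp delta p x d0); apply: ge0_le_integral => //=.
- by apply/measurable_EFinP; exact: measurableT_comp.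
- apply/measurable_EFinP; apply: measurableT_comp => //.
  by apply: measurable_funM => //; exact: measurableT_comp.
- by move=> v _; rewrite lee_fin.
Qed.

Lemma Gam_id_integrable delta x : 0 < delta ->
  (Gam delta x).-integrable [set: R] (EFin \o id).
Proof.
move=> d0; apply: (Gam_dominated_integrable (p := 1) _ d0) => // v.
by rewrite mul1r le_norm_expR.
Qed.

Lemma Gam_sqr_integrable delta x : 0 < delta ->
  (Gam delta x).-integrable [set: R] (EFin \o (fun v : R => v ^+ 2)).
Proof.
move=> d0; apply: (Gam_dominated_integrable (p := 2) _ d0) => // v.
rewrite ger0_norm ?sqr_ge0//; have := qexp_le_expR 0 v.
by rewrite /qexp mul0r expR0 mulr1 add0r.
Qed.

(** Jumps of size at most [1] are controlled by the second moment, the larger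
    ones by uniform exponential finiteness. *)
Lemma Gam_qexp_le (p : R) : exists2 C, 0 <= C &
  \forall delta \near (0 : R)^'+, forall x,
    (\int[Gam delta x]_v (qexp p v)%:E <= (C * delta ^+ 2)%:E)%E.
Proof.
have [ _ _ [_ [M cM]] [thea [thec [_ nc hm]]]] := hmean.
have [C hC] := huexp (p + 2).
have M0 : 0 <= M by exact: le_trans (cM x0).
exists (expR `|p| * (M + 1) + `|C|).
  by rewrite addr_ge0 ?mulr_ge0 ?expR_ge0 ?addr_ge0.
have hth := negligible_termP nc ltr01.
near=> delta => x.
have d0 : 0 < delta by near: delta; exact: nbhs_right_gt.
pose A : set R := [set v : R | (1 < `|v|)%R].
have mA : measurable A.
  rewrite /A -[X in measurable X]setTI.
  have -> : [set v : R | 1 < `|v|] = (fun v : R => `|v|) @^-1` `]1, +oo[.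
    by apply/seteqP; split => v /=; rewrite in_itv/= andbT.
  exact: (@normr_measurable R setT).
pose g (v : R) := expR ((p + 2) * `|v|).
have mg : measurable_fun [set: R] (EFin \o g).
  apply/measurable_EFinP; apply: measurableT_comp => //.
  by apply: measurable_funM => //; exact: measurableT_comp.
have msq : measurable_fun [set: R] (fun v : R => (v ^+ 2)%:E).
  by apply/measurable_EFinP; exact: exprn_measurable.
have mgA : measurable_fun [set: R] (fun v => ((EFin \o g) \_ A) v).
  by apply/(measurable_restrictT _ mA); apply: measurable_funTS.
apply: (@le_trans _ _ (\int[Gam delta x]_v
    ((expR `|p|)%:E * (v ^+ 2)%:E + ((EFin \o g) \_ A) v))%E).
  apply: ge0_le_integral => //.
  - by move=> v _; rewrite lee_fin qexp_ge0.
  - by apply/measurable_EFinP; exact: measurable_qexp.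
  - by apply: emeasurable_funD => //; exact: measurable_funeM.
  move=> v _; rewrite patchE; case: ifPn => [_|].
    rewrite -EFinM -EFinD lee_fin (le_trans (qexp_le_expR _ _))// lerDr.
    by rewrite mulr_ge0 ?expR_ge0 ?sqr_ge0.
  rewrite notin_setE /A/= => /negP; rewrite -leNgt => v1.
  rewrite adde0 -EFinM lee_fin /qexp mulrC ler_wpM2r ?sqr_ge0// ler_expR.
  apply: le_trans (ler_norm _) _; rewrite normrM normr_id.
  by rewrite ler_piMr.
rewrite ge0_integralD//; first last.
- by move=> v _; rewrite patchE; case: ifPn => // _; rewrite lee_fin expR_ge0.
- exact: measurable_funeM.
- by move=> v _; rewrite -EFinM lee_fin mulr_ge0 ?expR_ge0 ?sqr_ge0.
rewrite ge0_integralZl ?lee_fin ?expR_ge0//; last first.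
  by move=> v _; rewrite lee_fin sqr_ge0.
rewrite -integral_mkcond.
have sqE : (\int[Gam delta x]_v (v ^+ 2)%:E)%E =
    (\int[Gam delta x]_v (v ^+ 2))%:E.
  rewrite /Rintegral fineK//.
  exact: (integrable_fin_num measurableT (Gam_sqr_integrable x d0)).
rewrite sqE (hm _ _ d0).2 mulrDl EFinD; apply: leeD.
  rewrite -EFinM lee_fin -[leRHS]mulrA ler_wpM2l ?expR_ge0//.
  rewrite [leLHS]mulrC ler_wpM2r ?sqr_ge0//.
  apply: lerD; first by rewrite (le_trans (ler_norm _)).
  apply: le_trans (ler_norm _) _.
  by move: x {sqE}; near: delta.
apply: (@le_trans _ _ (C * delta ^+ 2)%:E).
  by move: x {sqE}; rewrite /A; near: delta.
by rewrite lee_fin ler_wpM2r ?sqr_ge0// ler_norm.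
Unshelve. all: by end_near. Qed.

End levy_moments.

(** * Passage to the limit intensity kernel *)

Section damp_limit.
Context (R : realType).

Lemma damp_anti (eta1 eta2 q v : R) : 0 < eta1 -> eta1 <= eta2 ->
  damp eta2 q v <= damp eta1 q v.
Proof.
move=> e0 e12; have e20 := lt_le_trans e0 e12.
rewrite ler_wpM2l// lef_pV2 ?posrE ?damp_den_gt0//.
by rewrite lerD2l ler_wpM2r ?expR_ge0.
Qed.

Lemma damp_harmonic_cvg (q v : R) : v != 0 ->
  damp n.+1%:R^-1 q v @[n --> \oo] --> (1 : R).
Proof.
move=> v0; have nv0 : `|v| != 0 by rewrite normr_eq0.
have h : damp eta q v @[eta --> (0 : R)] --> (1 : R).
  have -> : (1 : R) = damp 0 q v by rewrite /damp mul0r addr0 divff.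
  apply: cvgM; first exact: cvg_cst.
  apply: cvgV; first by rewrite mul0r addr0.
  by apply: cvgD; [exact: cvg_cst|exact: mulrr_continuous].
exact: (cvg_comp _ _ (@cvg_harmonic R) h).
Qed.

End damp_limit.

Section levy_limit.
Context (R : realType) (d : measure_display) (E : measurableType d).
Variables (Gam : R -> R.-ker E ~> R) (Gam0 : R.-ker E ~> R) (a1 a c : E -> R).
Variable x0 : E.
Hypothesis hmean : mean_approximation Gam a1 a c.
Hypothesis hintensity : intensity_representation Gam Gam0.
Hypothesis hexp : exponential_finiteness Gam.
Hypothesis huexp : uniform_exponential_finiteness Gam.

Let Gam_qexp := Gam_qexp_le x0 hmean hexp huexp.
Let negP (theta : R -> E -> R) := @negligible_termP R d E x0 theta.

Lemma Gam0_damp_le (p C : R) : 0 <= C ->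
  (\forall delta \near (0 : R)^'+, forall x,
    (\int[Gam delta x]_v (qexp p v)%:E <= (C * delta ^+ 2)%:E)%E) ->
  forall eta x, 0 < eta ->
    (\int[Gam0 x]_v (qexp p v * damp eta (p + 3) v)%:E <= C%:E)%E.
Proof.
move=> C0 hC eta x eta0.
pose w v := qexp p v * damp eta (p + 3) v.
have wC3 : C_3 w.
  apply: (C_3_damp (C := 1)) => //; first exact: continuous_qexp.
  by move=> v; rewrite mul1r ger0_norm// qexp_ge0.
have mw : measurable_fun [set: R] w.
  by apply: continuous_measurable_fun; case: wC3.
have [wi _ [th nth hth]] := hintensity wC3.
have -> : (\int[Gam0 x]_v (w v)%:E)%E = (\int[Gam0 x]_v w v)%:E.
  by rewrite /Rintegral fineK//; exact: (integrable_fin_num measurableT (wi x)).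
rewrite lee_fin; apply/ler_addgt0Pr => e e0.
have hn := negP nth e0.
near (0 : R)^'+ => delta.
have d0 : 0 < delta by near: delta; exact: nbhs_right_gt.
have hV : (\int[Gam delta x]_v (qexp p v)%:E <= (C * delta ^+ 2)%:E)%E.
  by move: (x); near: delta.
have hth1 : `|th delta x| <= e by move: (x); near: delta.
have := norm_Rintegral_qexp_le hV ler01 mw.
rewrite mul1r => /(_ _)/wrap[].
  move=> v; rewrite mul1r normrM !ger0_norm ?qexp_ge0 ?damp_ge0//.
  by rewrite ler_piMr ?qexp_ge0// damp_le1.
rewrite hth// => /(le_trans (ler_norm _)); rewrite mulrC ler_pM2r ?exprn_gt0//.
by move: hth1; rewrite ler_norml => /andP[]; lra.
Unshelve. all: by end_near. Qed.

(** The damped weights belong to the class [C_3], so that their integrals pass to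
    the limit in [delta]; they increase to the weight as the damping vanishes,
    and monotone convergence applies. *)
Lemma Gam0_qexp_le (p : R) : exists2 C, 0 <= C &
  forall x, (\int[Gam0 x]_v (qexp p v)%:E <= C%:E)%E.
Proof.
have [C C0 hC] := Gam_qexp p; exists C => // x.
pose w n v := (qexp p v * damp n.+1%:R^-1 (p + 3) v)%:E.
have n0 n : 0 < n.+1%:R^-1 :> R by rewrite invr_gt0.
have -> : (\int[Gam0 x]_v (qexp p v)%:E =
           \int[Gam0 x]_v limn (fun n => w n v))%E.
  apply: eq_integral => v _; apply/esym/cvg_lim => //.
  apply/fine_cvgP; split; first exact: nearW.
  have [->|v0] := eqVneq v 0.
    rewrite /w /qexp expr0n !mul0r/=.
    by apply: cvg_near_cst; apply: nearW => n /=; rewrite !mul0r.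
  rewrite -[X in _ --> X]mulr1.
  by apply: cvgMr; exact: damp_harmonic_cvg.
have wc n : continuous (fun v => qexp p v * damp n.+1%:R^-1 (p + 3) v).
  by move=> v; apply: cvgM; [exact: continuous_qexp|exact: continuous_damp].
have mw n : measurable_fun [set: R] (w n).
  by apply/measurable_EFinP; exact: continuous_measurable_fun.
have w0 n v : [set: R] v -> (0 <= w n v)%E.
  by rewrite lee_fin mulr_ge0 ?qexp_ge0 ?damp_ge0.
have nd v : [set: R] v -> nondecreasing_seq (w^~ v).
  move=> _ m n mn; rewrite lee_fin ler_wpM2l ?qexp_ge0// damp_anti//.
  by rewrite lef_pV2 ?posrE// ler_nat.
rewrite monotone_convergence//.
apply: lime_le.
  apply: ereal_nondecreasing_is_cvgn => m n mn.
  apply: ge0_le_integral => //; first by move=> v _; exact: w0.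
  by move=> v _; exact: nd.
by apply: nearW => n; exact: Gam0_damp_le.
Qed.

(** The asymptotic representation of the intensity kernels extends from bounded
    functions to functions of exponential growth which are cubic at the
    origin. *)
Lemma Gam_cvg_exp_growth (g : R -> R) (C p : R) : 0 <= C -> continuous g ->
  (forall v, `|g v| <= C * (`|v| ^+ 3 * expR (p * `|v|))) ->
  forall e, 0 < e -> \forall delta \near (0 : R)^'+, forall x,
    `|\int[Gam delta x]_v g v - delta ^+ 2 * \int[Gam0 x]_v g v|
      <= e * delta ^+ 2.
Proof.
move=> C0 gc gC e e0.
(* the damping exponent which C_3_damp requires for the bound p + 1 *)
pose q := p + 1 + 3.
have [C1 C10 hC1] := Gam_qexp (p + q).
have [C2 C20 hC2] := Gam0_qexp_le (p + q).
have [C3 C30 hC3] := Gam_qexp (p + 1).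
have [C4 C40 hC4] := Gam0_qexp_le (p + 1).
have gq v : `|g v| <= C * qexp (p + 1) v.
  by apply: le_trans (gC v) _; rewrite ler_wpM2l ?cube_le_qexp.
(* with this damping, the errors for both kernels add up to at most e / 2 *)
pose eta := e / 2 / (C * (C1 + C2) + 1).
have den0 : 0 < C * (C1 + C2) + 1.
  by rewrite ltr_wpDl// mulr_ge0// addr_ge0.
have eta0 : 0 < eta by rewrite !divr_gt0.
pose h v := g v * damp eta q v.
have hC_3 : C_3 h by exact: C_3_damp.
have mg : measurable_fun [set: R] g by exact: continuous_measurable_fun.
have mh : measurable_fun [set: R] h.
  by apply: continuous_measurable_fun; case: hC_3.
have hq v : `|h v| <= C * qexp (p + 1) v.
  rewrite normrM (ger0_norm (damp_ge0 _ eta0 _)); apply: le_trans (gq v).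
  by rewrite ler_piMr// damp_le1.
have ghq v : `|g v - h v| <= C * eta * qexp (p + q) v.
  rewrite /h -{1}(mulr1 (g v)) -mulrBr normrM.
  have d1 := damp_le1 q eta0 v; have d0 := damp_ge0 q eta0 v.
  rewrite (ger0_norm (_ : 0 <= 1 - damp eta q v)) ?subr_ge0//.
  apply: le_trans (ler_wpM2r _ (gC v)) _; first by rewrite subr_ge0.
  have -> : C * (`|v| ^+ 3 * expR (p * `|v|)) * (1 - damp eta q v) =
    C * expR (p * `|v|) * (`|v| ^+ 3 * (1 - damp eta q v)) by ring.
  have -> : C * eta * qexp (p + q) v = C * expR (p * `|v|) * (eta * qexp q v).
    by rewrite /qexp mulrDl expRD; ring.
  by rewrite ler_wpM2l ?mulr_ge0 ?expR_ge0// cube_undamp_le.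
have mgh : measurable_fun [set: R] (fun v => g v - h v) by exact: measurable_funB.
have key (mu : {measure set R -> \bar R}) V V' :
    (\int[mu]_v (qexp (p + q) v)%:E <= V%:E)%E ->
    (\int[mu]_v (qexp (p + 1) v)%:E <= V'%:E)%E ->
    `|\int[mu]_v g v - \int[mu]_v h v| <= C * eta * V.
  move=> hV hV'; rewrite -RintegralB//; last 2 first.
  - exact: (le_qexp_integrable hV' mg gq).
  - exact: (le_qexp_integrable hV' mh hq).
  by apply: (norm_Rintegral_qexp_le hV) => //; rewrite mulr_ge0// ltW.
have [_ _ [th nth hth]] := hintensity hC_3.
have e20 : 0 < e / 2 by rewrite divr_gt0.
have hn := negP nth e20.
near=> delta => x.
have d0 : 0 < delta by near: delta; exact: nbhs_right_gt.
have k1 : `|\int[Gam delta x]_v g v - \int[Gam delta x]_v h v| <=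
    C * eta * (C1 * delta ^+ 2).
  by apply: (key _ _ (C3 * delta ^+ 2)); move: (x); near: delta.
have k2 := key _ _ _ (hC2 x) (hC4 x).
have k3 : `|th delta x| <= e / 2 by move: (x); near: delta.
move: k1; rewrite hth// => k1.
set Ig := \int[Gam delta x]_v g v in k1 *.
set I0 := \int[Gam0 x]_v g v in k2 *.
set H := \int[Gam0 x]_v h v in k1 k2 *.
have -> : Ig - delta ^+ 2 * I0 = (Ig - delta ^+ 2 * (H + th delta x)) -
   delta ^+ 2 * (I0 - H) + delta ^+ 2 * th delta x by ring.
have d2 : 0 < delta ^+ 2 by rewrite exprn_gt0.
apply: le_trans (ler_normD _ _) _.
apply: (@le_trans _ _ ((C * eta * (C1 * delta ^+ 2) +
    delta ^+ 2 * (C * eta * C2)) + delta ^+ 2 * (e / 2))).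
  apply: lerD.
    apply: le_trans (ler_normB _ _) _; apply: lerD => //.
    by rewrite normrM gtr0_norm// ler_pM2l.
  by rewrite normrM gtr0_norm// ler_pM2l.
have ee : eta * (C * (C1 + C2)) <= e / 2.
  rewrite /eta mulrAC ler_pdivrMr// ler_pM2l//; lra.
nra.
Unshelve. all: by end_near. Qed.

End levy_limit.

(** * Fubini for mixtures of kernels *)

Section kernel_integral.
Context (R : realType) (d d' : measure_display).
Context (E : measurableType d) (Y : measurableType d').
Variables (pi : probability E R) (K : R.-ker E ~> Y).

Lemma measurable_ge0_integral_kernel (f : Y -> \bar R) :
  (forall y, 0 <= f y)%E -> measurable_fun [set: Y] f ->
  measurable_fun [set: E] (fun x => (\int[K x]_y f y)%E).
Proof.
move=> f0 mf; apply: measurable_fun_integral_kernel => // U mU.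
exact: measurable_kernel.
Qed.

Lemma measurable_Rintegral_kernel (f : Y -> R) : measurable_fun [set: Y] f ->
  measurable_fun [set: E] (fun x => \int[K x]_y f y).
Proof.
move=> mf; apply: measurableT_comp => //.
have mEf : measurable_fun [set: Y] (EFin \o f) by exact/measurable_EFinP.
rewrite [X in measurable_fun _ X](_ : _ = (fun x =>
    \int[K x]_y (EFin \o f)^\+ y - \int[K x]_y (EFin \o f)^\- y)%E); last first.
  by apply/funext => x; rewrite integralE.
apply: emeasurable_funB; apply: measurable_ge0_integral_kernel => //.
- exact: measurable_funepos.
- exact: measurable_funeneg.
Qed.

Import HBNNSimple.

Let integral_mixture_nnsfun (f : {nnsfun Y >-> R}) :
  (\int[mixture pi K]_y (f y)%:E = \int[pi]_x \int[K x]_y (f y)%:E)%E.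
Proof.
have fE (mu : {measure set Y -> \bar R}) : (\int[mu]_y (f y)%:E =
    \sum_(r \in range f) r%:E * mu (f @^-1` [set r]))%E.
  under eq_integral do rewrite fimfunE -fsumEFin//.
  rewrite ge0_integral_fsum//; last 2 first.
  - by move=> r; exact/measurable_EFinP/measurableT_comp.
  - by move=> r y _; rewrite EFinM nnfun_muleindic_ge0.
  apply: eq_fsbigr => r _.
  rewrite (integralZl_indic _ (fun r => f @^-1` [set r]))//; last first.
    by move=> r0; rewrite preimage_nnfun0.
  by rewrite integral_indic// setIT.
rewrite fE; under [in RHS]eq_integral do rewrite fE.
rewrite ge0_integral_fsum//; last 2 first.
- move=> r; apply: measurable_funeM; exact: measurable_kernel.
- move=> r x _; have [r0|r0] := leP 0 r; first by rewrite mule_ge0.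
  by rewrite preimage_nnfun0// measure0 mule0.
apply: eq_fsbigr => r _; rewrite /= /mixture.
have [r0|r0] := leP 0 r; first by rewrite ge0_integralZl//; exact: measurable_kernel.
rewrite preimage_nnfun0//; under eq_integral do rewrite measure0.
by under [in RHS]eq_integral do rewrite measure0 mule0; rewrite integral0 mule0.
Qed.

Lemma ge0_integral_mixture (f : Y -> \bar R) :
  (forall y, 0 <= f y)%E -> measurable_fun [set: Y] f ->
  (\int[mixture pi K]_y f y = \int[pi]_x \int[K x]_y f y)%E.
Proof.
move=> f0 mf; pose f_ := nnsfun_approx measurableT mf.
have mf_ n : measurable_fun [set: Y] (fun y => (f_ n y)%:E).
  exact/measurable_EFinP.
have f_0 n y : [set: Y] y -> (0 <= (f_ n y)%:E)%E by rewrite lee_fin.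
have ndf y : [set: Y] y -> nondecreasing_seq (fun n => (f_ n y)%:E).
  by move=> _ m n mn; rewrite lee_fin; exact/lefP/nd_nnsfun_approx.
have lim_f y : f y = limn (fun n => (f_ n y)%:E).
  by apply/esym/cvg_lim => //; exact: cvg_nnsfun_approx.
have intE (mu : {measure set Y -> \bar R}) :
    (\int[mu]_y f y = limn (fun n => \int[mu]_y (f_ n y)%:E))%E.
  rewrite -monotone_convergence//.
  by apply: eq_integral => y _; rewrite lim_f.
rewrite intE; under [in RHS]eq_integral do rewrite intE.
rewrite monotone_convergence//.
- by congr (limn _); apply/funext => n; exact: integral_mixture_nnsfun.
- by move=> n; apply: measurable_ge0_integral_kernel => // y; rewrite lee_fin.
- by move=> n x _; apply: integral_ge0 => y _; rewrite lee_fin.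
- move=> x _ m n mn; apply: ge0_le_integral => //.
  + by move=> y _; rewrite lee_fin.
  + by move=> y _; exact: ndf.
Qed.

(** Fubini for the mixture of an arbitrary, not necessarily s-finite, kernel. *)
Lemma Rintegral_mixture (f : Y -> R) :
  (mixture pi K).-integrable [set: Y] (EFin \o f) ->
  (forall x, (K x).-integrable [set: Y] (EFin \o f)) ->
  \int[mixture pi K]_y f y = \int[pi]_x \int[K x]_y f y.
Proof.
move=> fi Kf.
have mf : measurable_fun [set: Y] (EFin \o f) by exact: measurable_int fi.
rewrite /Rintegral; congr fine.
have -> : (\int[mixture pi K]_y (f y)%:E =
  \int[mixture pi K]_y (EFin \o f)^\+ y - \int[mixture pi K]_y (EFin \o f)^\- y)%E.
  by rewrite -integralE.
have mp := measurable_funepos mf; have mn := measurable_funeneg mf.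
rewrite !ge0_integral_mixture//.
rewrite -integralB//.
- apply: eq_integral => x _; rewrite fineK ?(integrable_fin_num measurableT (Kf x))//.
  by rewrite [in RHS]integralE.
- apply/integrableP; split; first exact: measurable_ge0_integral_kernel.
  under eq_integral do rewrite gee0_abs ?integral_ge0//.
  by rewrite -ge0_integral_mixture//; exact: integral_funepos_lt_pinfty.
- apply/integrableP; split; first exact: measurable_ge0_integral_kernel.
  under eq_integral do rewrite gee0_abs ?integral_ge0//.
  by rewrite -ge0_integral_mixture//; exact: integral_funeneg_lt_pinfty.
Qed.

End kernel_integral.

(** * Smooth families and the potential operator *)

Section bounded_measurable_theory.
Context (R : realType) (d : measure_display) (E : measurableType d).
Implicit Types f g : E -> R.

Lemma bounded_measurableD f g : bounded_measurable f -> bounded_measurable g ->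
  bounded_measurable (fun x => f x + g x).
Proof.
move=> [mf [M fM]] [mg [N gN]]; split; first exact: measurable_funD.
exists (M + N) => x; apply: le_trans (ler_normD _ _) _.
by apply: lerD.
Qed.

Lemma bounded_measurableM f g : bounded_measurable f -> bounded_measurable g ->
  bounded_measurable (fun x => f x * g x).
Proof.
move=> [mf [M fM]] [mg [N gN]]; split; first exact: measurable_funM.
by exists (M * N) => x; rewrite normrM ler_pM.
Qed.

Lemma bounded_measurable_cst (k : R) : bounded_measurable (fun _ : E => k).
Proof. by split; [exact: measurable_cst|exists `|k|]. Qed.

Lemma bounded_measurableZ (k : R) f : bounded_measurable f ->
  bounded_measurable (fun x => k * f x).
Proof. by apply: bounded_measurableM; exact: bounded_measurable_cst. Qed.

Lemma bounded_measurable_integrable (mu : {measure set E -> \bar R}) f :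
  mu [set: E] = 1%E -> bounded_measurable f ->
  mu.-integrable [set: E] (EFin \o f).
Proof.
move=> mu1 [mf [M fM]]; apply: measurable_bounded_integrable => //.
  by rewrite mu1 ltry.
exists M; split; first exact: num_real.
by move=> N MN x _; exact: le_trans (fM x) (ltW MN).
Qed.

End bounded_measurable_theory.

Section C11.
Context (R : realType) (T : Type).
Implicit Types (f D : R -> T -> R) (M : R).

(** Bounded functions of [u] with a first-order expansion whose coefficient [D]
    is bounded and whose remainder is quadratic, with one constant [M] for all
    [u] and all parameters in [T]. *)
Definition unif_C11 f D M := forall u x,
  [/\ `|f u x| <= M, `|D u x| <= M &
      forall h, `|f (u + h) x - f u x - h * D u x| <= M * h ^+ 2].

Lemma unif_C11_lipschitz f D M : unif_C11 f D M ->
  forall u h x, `|f (u + h) x - f u x| <= 2 * M * `|h|.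
Proof.
move=> fD u h x; have [fM DM /(_ h) rM] := fD u x; have [fM' _ _] := fD (u + h) x.
have M0 : 0 <= M by exact: le_trans fM.
have [h1|/ltW h1] := leP 1 `|h|.
  have : M <= M * `|h| by rewrite ler_peMr.
  by have := ler_normB (f (u + h) x) (f u x); lra.
rewrite -(subrK (h * D u x) (_ - f u x)) (le_trans (ler_normD _ _))//.
have : `|h * D u x| <= M * `|h| by rewrite normrM mulrC ler_wpM2r.
move: rM; rewrite -(@real_normK _ h) ?num_real// => rM.
have : M * `|h| ^+ 2 <= M * `|h|.
  by rewrite ler_wpM2l// expr2 ler_piMr.
lra.
Qed.

Lemma unif_C11_continuous f D M : unif_C11 f D M ->
  forall x, continuous (f^~ x).
Proof.
move=> fD x u; apply/cvgrPdist_le => e e0.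
have M0 : 0 <= M by have [+ _ _] := fD 0 x; exact: le_trans.
have M1 : 0 < 2 * M + 1 by lra.
near=> y.
rewrite distrC -{1}(subrKC u y).
apply: le_trans (unif_C11_lipschitz fD _ _ _) _.
have : `|y - u| <= e / (2 * M + 1).
  rewrite distrC; near: y; apply: cvgr_dist_le; first exact: cvg_id.
  by rewrite divr_gt0.
rewrite ler_pdivlMr// => h; have := normr_ge0 (y - u); nra.
Unshelve. all: by end_near. Qed.

(** Composition of a family [F s], smooth for [s] bounded by [K], with a smooth
    function [psi] with values in this range. *)
Lemma unif_C11_comp (F F' : R -> T -> R) (K C : R) (psi dpsi : R -> R) : 0 <= C ->
  (forall s x, `|s| <= K -> `|F s x| <= C /\ `|F' s x| <= C) ->
  (forall s t x, `|s| <= K -> `|t| <= K ->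
    `|F t x - F s x - (t - s) * F' s x| <= C * (t - s) ^+ 2) ->
  (forall u, `|psi u| <= K) -> (forall u, `|dpsi u| <= K) ->
  (forall u h, `|psi (u + h) - psi u| <= K * `|h|) ->
  (forall u h, `|psi (u + h) - psi u - h * dpsi u| <= K * h ^+ 2) ->
  unif_C11 (fun u x => F (psi u) x) (fun u x => dpsi u * F' (psi u) x)
    (C + K * C + C * K ^+ 2).
Proof.
move=> C0 FC FE pK dK pL pE u x; have [F1 F2] := FC _ x (pK u).
have K0 : 0 <= K by exact: le_trans (pK 0).
have CK : 0 <= C * K ^+ 2 by rewrite mulr_ge0 ?exprn_ge0.
have KC : 0 <= K * C by rewrite mulr_ge0.
split; first lra.
- rewrite normrM; suff : `|dpsi u| * `|F' (psi u) x| <= K * C by lra.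
  exact: ler_pM.
- move=> h; have := FE _ _ x (pK u) (pK (u + h)).
  set t := psi (u + h); set s := psi u => h1.
  have -> : F t x - F s x - h * (dpsi u * F' s x) =
    (F t x - F s x - (t - s) * F' s x) + (t - s - h * dpsi u) * F' s x by ring.
  apply: le_trans (ler_normD _ _) _; rewrite normrM.
  have h2 : `|t - s - h * dpsi u| * `|F' s x| <= K * h ^+ 2 * C.
    by apply: ler_pM => //; exact: pE.
  have h3 : (t - s) ^+ 2 <= K ^+ 2 * h ^+ 2.
    rewrite -(@real_normK _ (t - s)) ?num_real// -(@real_normK _ h) ?num_real//.
    by rewrite -exprMn lerXn2r ?nnegrE ?mulr_ge0//; exact: pL.
  have h4 := sqr_ge0 h.
  have : C * (t - s) ^+ 2 <= C * (K ^+ 2 * h ^+ 2) by rewrite ler_wpM2l.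
  have : 0 <= C * h ^+ 2 by rewrite mulr_ge0.
  lra.
Qed.

End C11.

Section potential_theory.
Context (R : realType) (d : measure_display) (E : measurableType d).
Variables (q : E -> R) (P : R.-pker E ~> E) (pi : probability E R).
Variable R0 : (E -> R) -> E -> R.
Hypothesis hR0 : potential q P pi R0.

Lemma potential_bounded : exists2 C, 0 <= C & forall f M, bounded_measurable f ->
  (forall x, `|f x| <= M) -> forall x, `|R0 f x| <= C * M.
Proof.
have [_ _ [C hC] _ _] := hR0; exists `|C| => // f M bf fM x.
rewrite -lee_fin (le_trans (supnorm_ge _ _))// (le_trans (hC f bf))//.
have s0 : (0 <= supnorm f)%E.
  by apply: (le_trans _ (supnorm_ge f x)); rewrite lee_fin.
apply: (@le_trans _ _ (`|C|%:E * supnorm f)%E).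
  by rewrite lee_wpmul2r// lee_fin ler_norm.
by rewrite EFinM lee_wpmul2l// ?lee_fin// supnorm_le.
Qed.

(** A family of functions which is smooth in its parameter, uniformly on [E],
    remains so under the potential operator. *)
Lemma potential_expansion (A A' : R -> E -> R) (K C : R) :
  (forall s, bounded_measurable (A s)) -> (forall s, bounded_measurable (A' s)) ->
  (forall s x, `|s| <= K -> `|A s x| <= C /\ `|A' s x| <= C) ->
  (forall s t x, `|s| <= K -> `|t| <= K ->
    `|A t x - A s x - (t - s) * A' s x| <= C * (t - s) ^+ 2) ->
  exists2 C', 0 <= C' &
  (forall s x, `|s| <= K -> `|R0 (A s) x| <= C' /\ `|R0 (A' s) x| <= C') /\
  (forall s t x, `|s| <= K -> `|t| <= K ->
    `|R0 (A t) x - R0 (A s) x - (t - s) * R0 (A' s) x| <= C' * (t - s) ^+ 2).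
Proof.
move=> bA bA' AC AE; have [C1 C10 hC1] := potential_bounded.
have [_ lin _ _ _] := hR0.
exists (C1 * `|C|); first by rewrite mulr_ge0.
split=> [s x sK|s t x sK tK].
  by split; (apply: hC1 => // y; apply: (@le_trans _ _ C); last exact: ler_norm);
    have [] := AC s y sK.
pose e y := A t y + (- (t - s) * A' s y + - 1 * A s y).
have be : bounded_measurable e.
  apply: bounded_measurableD => //.
  by apply: bounded_measurableD; exact: bounded_measurableZ.
have eE : (fun y => - (t - s) * A' s y + (- 1 * A s y + A t y)) = e.
  by apply/funext => y; rewrite /e; ring.
have bl : bounded_measurable (fun y => - 1 * A s y + A t y).
  by apply: bounded_measurableD => //; exact: bounded_measurableZ.
have := lin (- (t - s)) (A' s) _ (bA' s) bl.
rewrite eE lin// => /(congr1 (fun k => k x)) R0e.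
have -> : R0 (A t) x - R0 (A s) x - (t - s) * R0 (A' s) x = R0 e x.
  by rewrite R0e; ring.
rewrite -mulrA; apply: hC1 => // y.
have -> : e y = A t y - A s y - (t - s) * A' s y by rewrite /e; ring.
apply: le_trans (AE _ _ _ sK tK) _.
by rewrite ler_wpM2r ?sqr_ge0// ler_norm.
Qed.

End potential_theory.

(** * The compensated exponent of the limit kernel *)

Section compensated_exponent.
Context (R : realType) (d : measure_display) (E : measurableType d).
Variables (Gam0 : R.-ker E ~> R) (pi : probability E R).
Hypothesis qexp0 : forall p : R, exists2 C, 0 <= C &
  forall x, (\int[Gam0 x]_v (qexp p v)%:E <= C%:E)%E.

(** The compensated exponent of the limit intensity kernel, and its derivative
    in [s]. Compensating the linear term makes the integral bounded in [x],
    which the drift [a_0] need not be; compensating the quadratic one makes the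
    integrand o(v^2) at the origin. *)
Definition levy_exponent (s : R) (x : E) : R := \int[Gam0 x]_v levy_rem s v.

Definition levy_exponent_deriv (s : R) (x : E) : R :=
  \int[Gam0 x]_v levy_rem_deriv s v.

Lemma measurable_levy_rem (s : R) : measurable_fun [set: R] (levy_rem s).
Proof. by apply: continuous_measurable_fun; exact: continuous_levy_rem. Qed.

Lemma measurable_levy_rem_deriv (s : R) :
  measurable_fun [set: R] (levy_rem_deriv s).
Proof.
by apply: continuous_measurable_fun; exact: continuous_levy_rem_deriv.
Qed.

Lemma levy_exponent_expansion (K : R) : 0 <= K -> exists2 C, 0 <= C &
  (forall s x, `|s| <= K ->
     `|levy_exponent s x| <= C /\ `|levy_exponent_deriv s x| <= C) /\
  (forall s t x, `|s| <= K -> `|t| <= K ->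
     `|levy_exponent t x - levy_exponent s x - (t - s) * levy_exponent_deriv s x|
       <= C * (t - s) ^+ 2).
Proof.
move=> K0; have [C1 C10 hC1] := qexp0 (K + 1); have [C2 C20 hC2] := qexp0 (3 * K).
have K2 : 0 <= K ^+ 2 by exact: sqr_ge0.
have K3 : 0 <= K ^+ 3 by rewrite exprn_ge0.
have b1 s v : `|s| <= K -> `|levy_rem s v| <= K ^+ 3 * qexp (K + 1) v.
  move=> sK; apply: le_trans (norm_levy_rem_le v sK) _.
  by rewrite ler_wpM2l ?cube_le_qexp.
have b2 s v : `|s| <= K -> `|levy_rem_deriv s v| <= K ^+ 2 * qexp (K + 1) v.
  move=> sK; apply: le_trans (norm_levy_rem_deriv_le v sK) _.
  by rewrite ler_wpM2l ?cube_le_qexp.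
have i1 s x : `|s| <= K -> (Gam0 x).-integrable [set: R] (EFin \o levy_rem s).
  move=> sK; apply: (le_qexp_integrable (hC1 x) (measurable_levy_rem s)) => v.
  exact: b1.
have i2 s x : `|s| <= K -> (Gam0 x).-integrable [set: R] (EFin \o levy_rem_deriv s).
  move=> sK; apply: (le_qexp_integrable (hC1 x) (measurable_levy_rem_deriv s)) => v.
  exact: b2.
have c1 : 0 <= K ^+ 3 * C1 by exact: mulr_ge0.
have c2 : 0 <= K ^+ 2 * C1 by exact: mulr_ge0.
exists (K ^+ 3 * C1 + K ^+ 2 * C1 + 2 * C2); first by rewrite !addr_ge0 ?mulr_ge0.
split=> [s x sK|s t x sK tK].
  split.
    apply: (@le_trans _ _ (K ^+ 3 * C1)); last lra.
    apply: (norm_Rintegral_qexp_le (hC1 x) K3 (measurable_levy_rem s)) => v.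
    exact: b1.
  apply: (@le_trans _ _ (K ^+ 2 * C1)); last lra.
  apply: (norm_Rintegral_qexp_le (hC1 x) K2 (measurable_levy_rem_deriv s)) => v.
  exact: b2.
pose m v := levy_rem t v - levy_rem s v - (t - s) * levy_rem_deriv s v.
have izd := integrableZl measurableT (t - s) (i2 s x sK).
have ib := integrableB measurableT (i1 t x tK) (i1 s x sK).
have -> : levy_exponent t x - levy_exponent s x - (t - s) * levy_exponent_deriv s x =
    \int[Gam0 x]_v m v.
  rewrite RintegralB// RintegralB//; [|exact: i1|exact: i1].
  by rewrite RintegralZl//; exact: i2.
apply: (@le_trans _ _ (2 * (t - s) ^+ 2 * C2)).
  apply: (norm_Rintegral_qexp_le (hC2 x)); first by rewrite mulr_ge0 ?sqr_ge0.
    apply: measurable_funB.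
      by apply: measurable_funB; exact: measurable_levy_rem.
    by apply: measurable_funM => //; exact: measurable_levy_rem_deriv.
  by move=> v; exact: levy_rem_expansion.
have := sqr_ge0 (t - s) => h; nra.
Qed.

Lemma bounded_levy_exponent s : bounded_measurable (levy_exponent s).
Proof.
split; first by apply: measurable_Rintegral_kernel; exact: measurable_levy_rem.
have [C _ [h _]] := levy_exponent_expansion (normr_ge0 s).
by exists C => x; have [] := h s x (lexx _).
Qed.

Lemma bounded_levy_exponent_deriv s : bounded_measurable (levy_exponent_deriv s).
Proof.
split.
  by apply: measurable_Rintegral_kernel; exact: measurable_levy_rem_deriv.
have [C _ [h _]] := levy_exponent_expansion (normr_ge0 s).
by exists C => x; have [] := h s x (lexx _).
Qed.

Lemma mixture_qexp_le p : exists2 C, 0 <= C &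
  (\int[mixture pi Gam0]_v (qexp p v)%:E <= C%:E)%E.
Proof.
have [C C0 hC] := qexp0 p; exists C => //.
have mq : measurable_fun [set: R] (fun v : R => (qexp p v)%:E).
  by apply/measurable_EFinP; exact: measurable_qexp.
have q0 v : (0 <= (qexp p v)%:E)%E by rewrite lee_fin qexp_ge0.
rewrite ge0_integral_mixture//.
apply: (@le_trans _ _ (\int[pi]_x (cst C%:E x))%E).
  apply: ge0_le_integral => //.
  - by move=> x _; exact: integral_ge0.
  - exact: measurable_ge0_integral_kernel.
by rewrite integral_cst// [X in (_ * X)%E](probability_setT pi) mule1.
Qed.

Hypothesis hfirst : first_moment_limit Gam0 pi.

(** The compensation can be undone after averaging over [E], because the drift
    of the averaged kernel is absolutely convergent. *)
Lemma Rintegral_levy_exponent s :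
  \int[mixture pi Gam0]_v (expR (v * s) - 1) =
  s * \int[pi]_x a_0 Gam0 x + s ^+ 2 / 2 * \int[pi]_x c_0 Gam0 x +
  \int[pi]_x levy_exponent s x.
Proof.
have [i0 im] := hfirst.
have [C1 C10 hC1] := qexp0 (`|s| + 1); have [C2 C20 hC2] := qexp0 0.
have [C3 C30 hC3] := mixture_qexp_le (`|s| + 1).
have [C4 C40 hC4] := mixture_qexp_le 0.
have bs (v : R) : `|v ^+ 2| <= 1 * qexp 0 v.
  by rewrite mul1r ger0_norm ?sqr_ge0// sqr_le_qexp.
have msq : measurable_fun [set: R] (fun v : R => v ^+ 2).
  exact: exprn_measurable.
have bl v : `|levy_rem s v| <= `|s| ^+ 3 * qexp (`|s| + 1) v.
  apply: le_trans (norm_levy_rem_le v (lexx _)) _.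
  by rewrite ler_wpM2l ?exprn_ge0// cube_le_qexp.
have ml := measurable_levy_rem s.
have sq0 x := le_qexp_integrable (hC2 x) msq bs.
have sqm := le_qexp_integrable hC4 msq bs.
have l0 x := le_qexp_integrable (hC1 x) ml bl.
have lm := le_qexp_integrable hC3 ml bl.
rewrite /a_0 /c_0 /levy_exponent -!Rintegral_mixture//.
have zi := integrableZl measurableT s im.
have zs := integrableZl measurableT (s ^+ 2 / 2) sqm.
rewrite -!RintegralZl//.
rewrite -RintegralD// -RintegralD//; last exact: (integrableD measurableT zi zs).
by apply: eq_Rintegral => v _; rewrite /levy_rem; field.
Qed.

End compensated_exponent.

(** * The exponential generator and its jump part *)

Section smooth_bounds.
Context (R : realType).

Lemma C3_smooth_bounds (phi : R -> R) : C3_smooth phi -> exists2 M, 0 <= M &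
  [/\ (forall u h, `|phi (u + h) - phi u| <= M * `|h|),
      (forall u h, `|phi (u + h) - phi u - h * derive1 phi u| <= M * h ^+ 2) &
  [/\ (forall u, `|derive1 phi u| <= M),
      (forall u, `|derive1 (derive1 phi) u| <= M),
      (forall u h, `|derive1 phi (u + h) - derive1 phi u| <= M * `|h|) &
      (forall u h, `|derive1 phi (u + h) - derive1 phi u
                     - h * derive1 (derive1 phi) u| <= M * h ^+ 2)]].
Proof.
move=> [dphi bphi].
have [_ [M1 h1]] := bphi 1 isT; have [_ [M2 h2]] := bphi 2 isT.
have [_ [M3 h3]] := bphi 3 isT.
have d0 := dphi 0 isT; have d1 := dphi 1 isT; have d2 := dphi 2 isT.
rewrite /derive1n/= in h1 h2 h3 d0 d1 d2.
have M10 : 0 <= M1 by exact: le_trans (h1 0).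
have M20 : 0 <= M2 by exact: le_trans (h2 0).
have M30 : 0 <= M3 by exact: le_trans (h3 0).
have sumr (M x : R) : 0 <= x -> M <= M1 + M2 + M3 -> M * x <= (M1 + M2 + M3) * x.
  by move=> x0 MM; exact: ler_wpM2r.
exists (M1 + M2 + M3); first by rewrite !addr_ge0.
split; [| |split].
- move=> u h; apply: le_trans (le_normB_derive1 d0 h1 _ _) _.
  by rewrite addrAC subrr add0r sumr//; lra.
- move=> u h; apply: le_trans (taylor1_derive1 d0 d1 h2 _ _) _.
  by rewrite sumr ?sqr_ge0//; lra.
- by move=> u; apply: le_trans (h1 u) _; lra.
- by move=> u; apply: le_trans (h2 u) _; lra.
- move=> u h; apply: le_trans (le_normB_derive1 d1 h2 _ _) _.
  by rewrite addrAC subrr add0r sumr//; lra.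
- move=> u h; apply: le_trans (taylor1_derive1 d1 d2 h3 _ _) _.
  by rewrite sumr ?sqr_ge0//; lra.
Qed.

End smooth_bounds.

Section scaling.
Context (R : realType).

Lemma levy_scaling_delta (Q : R -> Prop) : (\forall delta \near (0 : R)^'+, Q delta) ->
  \forall p \near levy_scaling R, Q p.2.
Proof.
move=> [r /= r0 hr]; exists r => // eps delta _ /andP[d0 dr] _ /=.
by apply: hr => //=; rewrite sub0r normrN gtr0_norm.
Qed.

Lemma levy_scaling_small (eta : R) : 0 < eta -> \forall p \near levy_scaling R,
  [/\ 0 < p.1 <= eta, 0 < p.2 <= eta & `|p.1^-1 * p.2 - 1| <= eta].
Proof.
move=> eta0; exists eta => // eps delta /andP[e0 e1] /andP[d0 d1] k.
by rewrite /= e0 d0 !ltW.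
Qed.

End scaling.

Section generator_formula.
Context (R : realType) (d : measure_display) (E : measurableType d).
Variables (Gam : R -> R.-ker E ~> R) (q : E -> R) (P : R.-pker E ~> E).

Let pkint (f : E -> R) x : bounded_measurable f ->
  (P x).-integrable [set: E] (EFin \o f).
Proof. by apply: bounded_measurable_integrable; exact: prob_kernel. Qed.

Lemma switchQ_linear (k1 k2 k3 : R) (f g : E -> R) x :
  bounded_measurable f -> bounded_measurable g ->
  switchQ q P (fun y => k1 + k2 * f y + k3 * g y) x =
  k2 * switchQ q P f x + k3 * switchQ q P g x.
Proof.
move=> bf bg; rewrite /switchQ.
have B (f' : E -> R) : bounded_measurable f' ->
    bounded_measurable (fun y => f' y - f' x).
  by move=> b; apply: bounded_measurableD => //; exact: bounded_measurable_cst.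
transitivity (q x * \int[P x]_y (k2 * (f y - f x) + k3 * (g y - g x))).
  by congr (_ * _); apply: eq_Rintegral => y _; ring.
rewrite [in LHS]RintegralD//; last 2 first.
- by apply: pkint; apply: bounded_measurableZ; exact: B.
- by apply: pkint; apply: bounded_measurableZ; exact: B.
rewrite [in LHS]RintegralZl//; last by apply: pkint; exact: B.
rewrite [in LHS]RintegralZl//; last by apply: pkint; exact: B.
ring.
Qed.

(** The exponential generator on a perturbed test function, with the factors
    [expR (phi u / eps)] cancelled. *)
Lemma exponential_generatorE (phi : R -> R) (phi1 phi2 : R -> E -> R)
    (eps delta u : R) x :
  let W u x := 1 + delta * phi1 u x + delta ^+ 2 * phi2 u x in
  let jump v := expR ((phi (u + eps * v) - phi u) / eps) * W (u + eps * v) x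
                - W u x in
  0 < eps -> (forall u x, 0 < W u x) ->
  bounded_measurable (phi1 u) -> bounded_measurable (phi2 u) ->
  (Gam delta x).-integrable [set: R] (EFin \o jump) ->
  exponential_generator Gam q P eps delta (perturbed phi phi1 phi2 eps delta) u x =
  eps ^- 2 * (W u x)^-1 * (delta * switchQ q P (phi1 u) x +
    delta ^+ 2 * switchQ q P (phi2 u) x + \int[Gam delta x]_v jump v).
Proof.
move=> W jump e0 W0 b1 b2 ij.
have ene : eps != 0 by rewrite gt_eqF.
have expE u' x' : expR (perturbed phi phi1 phi2 eps delta u' x' / eps) =
    expR (phi u' / eps) * W u' x'.
  rewrite /perturbed -/(W u' x') mulrDl expRD; congr (_ * _).
  by rewrite mulrAC divff// mul1r lnK// posrE.
rewrite /exponential_generator /evolution_generator /jump_generator/=.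
have -> : switchQ q P
    (fun x' => expR (perturbed phi phi1 phi2 eps delta u x' / eps)) x =
    expR (phi u / eps) * (delta * switchQ q P (phi1 u) x +
      delta ^+ 2 * switchQ q P (phi2 u) x).
  transitivity (expR (phi u / eps) * delta * switchQ q P (phi1 u) x +
      expR (phi u / eps) * delta ^+ 2 * switchQ q P (phi2 u) x); last by ring.
  rewrite -(switchQ_linear (expR (phi u / eps)))//.
  by congr (switchQ q P _ x); apply/funext => y; rewrite expE /W; ring.
have -> : \int[Gam delta x]_v
    (expR (perturbed phi phi1 phi2 eps delta (u + eps * v) x / eps) -
     expR (perturbed phi phi1 phi2 eps delta u x / eps)) =
    expR (phi u / eps) * \int[Gam delta x]_v jump v.
  rewrite -RintegralZl//; apply: eq_Rintegral => v _.
  rewrite !expE /jump mulrBr mulrA -expRD; congr (expR _ * _ - _).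
  by rewrite -mulrDl subrKC.
rewrite mulNr expRN expE.
set ep := expR _; have ep0 : ep != 0 by rewrite gt_eqF ?expR_gt0.
have Wn0 : W u x != 0 by rewrite gt_eqF.
by field; rewrite ep0 ene Wn0.
Qed.

End generator_formula.

Section jump_integral.
Context (R : realType) (mu : {measure set R -> \bar R}).
Variables (K M eps delta s D V V' : R).
Hypotheses (K0 : 0 <= K) (eps_gt0 : 0 < eps) (eps_le1 : eps <= 1).
Hypotheses (M0 : 0 <= M) (delta0 : 0 <= delta) (sK : `|s| <= K).
Hypothesis muV : (\int[mu]_v (qexp K v)%:E <= V%:E)%E.
Hypothesis muV' : (\int[mu]_v (qexp (K + 1) v)%:E <= V'%:E)%E.
Hypothesis mu_id : mu.-integrable [set: R] (EFin \o id).
Hypothesis mu_sqr : mu.-integrable [set: R] (EFin \o (fun v : R => v ^+ 2)).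
Variables (y z : R -> R) (z0 : R).
Hypotheses (my : measurable_fun [set: R] y) (mz : measurable_fun [set: R] z).
Hypotheses (yK : forall v, `|y v| <= K * `|v|)
  (ys : forall v, `|y v - v * s| <= M * eps * v ^+ 2).
Hypotheses (zM : forall v, `|z v| <= M)
  (zz : forall v, `|z v - z0| <= 2 * M * (eps * `|v|))
  (zD : forall v, `|z v - z0 - eps * v * D| <= M * (eps * v) ^+ 2).

Let C := M * (K ^+ 2 + M) + 2 * K * M + M.
Let jump v := expR (y v) * (1 + delta * z v) - (1 + delta * z0).
Let L v := (s + delta * (s * z0 + eps * D)) * v + s ^+ 2 / 2 * v ^+ 2 + levy_rem s v.

Let jump_rem v : `|jump v - L v| <= (M * eps + delta * C) * qexp K v.
Proof.
have -> : jump v - L v =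
  (expR (y v) - 1 - (v * s + (v * s) ^+ 2 / 2 + levy_rem s v)) +
  delta * (expR (y v) * z v - z0 - v * (s * z0 + eps * D)).
  by rewrite /jump /L; field.
apply: le_trans (ler_normD _ _) _; rewrite mulrDl; apply: lerD.
  exact: (expR_jump_levy_rem sK).
rewrite normrM ger0_norm// -mulrA ler_wpM2l//.
exact: (expR_jump_mul K0 eps_gt0).
Qed.

Let mjump : measurable_fun [set: R] jump.
Proof.
apply: measurable_funB => //; apply: measurable_funM.
  exact: measurableT_comp.
by apply: measurable_funD => //; exact: measurable_funM.
Qed.

Let mL : measurable_fun [set: R] L.
Proof.
apply: measurable_funD; last exact: measurable_levy_rem.
by apply: measurable_funD; apply: measurable_funM => //; exact: exprn_measurable.
Qed.

Let iZ1 := integrableZl measurableT (s + delta * (s * z0 + eps * D)) mu_id.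
Let iZ2 := integrableZl measurableT (s ^+ 2 / 2) mu_sqr.

Let iG : mu.-integrable [set: R] (EFin \o levy_rem s).
Proof.
apply: (le_qexp_integrable (C := K ^+ 3) muV'); first exact: measurable_levy_rem.
move=> v; apply: le_trans (norm_levy_rem_le v sK) _.
by rewrite ler_wpM2l ?exprn_ge0// cube_le_qexp.
Qed.

Let iD : mu.-integrable [set: R] (EFin \o (fun v => jump v - L v)).
Proof.
apply: (le_qexp_integrable muV _ jump_rem); exact: measurable_funB.
Qed.

Let iL : mu.-integrable [set: R] (EFin \o L).
Proof.
exact: (integrableD measurableT (integrableD measurableT iZ1 iZ2) iG).
Qed.

Lemma jump_integrable : mu.-integrable [set: R] (EFin \o jump).
Proof.
apply: eq_integrable (integrableD measurableT iD iL) => // v _.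
by rewrite /= -EFinD subrK.
Qed.

(** The jump part of the exponential generator is determined by the first two
    moments and the compensated exponent, up to a remainder of the order of
    [eps + delta] times the integral of the weight. *)
Lemma jump_integral_expansion :
  `|\int[mu]_v jump v -
    ((s + delta * (s * z0 + eps * D)) * \int[mu]_v v +
     s ^+ 2 / 2 * \int[mu]_v (v ^+ 2) + \int[mu]_v levy_rem s v)|
  <= (M * eps + delta * C) * V.
Proof.
rewrite -!RintegralZl// -RintegralD// -RintegralD//; last first.
  exact: (integrableD measurableT iZ1 iZ2).
rewrite -RintegralB//; last exact: jump_integrable.
apply: (norm_Rintegral_qexp_le muV) => //; last exact: measurable_funB.
by rewrite addr_ge0 ?mulr_ge0 ?addr_ge0 ?mulr_ge0 ?addr_ge0 ?sqr_ge0// ltW.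
Qed.

End jump_integral.

(** * Assembling the expansion *)

Section C11_sum.
Context (R : realType) (T : Type).

Lemma unif_C11D (f D g D' : R -> T -> R) (M N M' k : R) : 0 <= k <= 1 ->
  M + N <= M' -> unif_C11 f D M -> unif_C11 g D' N ->
  unif_C11 (fun u x => f u x + k * g u x) (fun u x => D u x + k * D' u x) M'.
Proof.
move=> /andP[k0 k1] MN fD gD u x.
have [f1 f2 f3] := fD u x; have [g1 g2 g3] := gD u x.
have N0 : 0 <= N by exact: le_trans g1.
have key (p q P Q : R) : 0 <= Q -> `|p| <= P -> `|q| <= Q -> `|p + k * q| <= P + Q.
  move=> Q0 pP qQ; apply: le_trans (ler_normD _ _) _; apply: lerD => //.
  by rewrite normrM ger0_norm//; apply: le_trans (ler_wpM2l k0 qQ) _; rewrite ler_piMl.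
split; [exact: le_trans (key _ _ _ _ N0 f1 g1) MN|
  exact: le_trans (key _ _ _ _ N0 f2 g2) MN|].
move=> h; have h2 := sqr_ge0 h.
have -> : f (u + h) x + k * g (u + h) x - (f u x + k * g u x)
    - h * (D u x + k * D' u x) =
  (f (u + h) x - f u x - h * D u x) + k * (g (u + h) x - g u x - h * D' u x).
  by ring.
apply: le_trans (key _ _ _ _ _ (f3 h) (g3 h)) _; first exact: mulr_ge0.
by rewrite -mulrDl ler_wpM2r.
Qed.

End C11_sum.

Section estimates.
Context (R : realType).
Implicit Types x y : R.

Let normM_le x y (X Y : R) : `|x| <= X -> `|y| <= Y -> `|x * y| <= X * Y.
Proof. by move=> xX yY; rewrite normrM ler_pM. Qed.

Let normD_le x y (X Y : R) : `|x| <= X -> `|y| <= Y -> `|x + y| <= X + Y.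
Proof. by move=> xX yY; apply: le_trans (ler_normD _ _) _; exact: lerD. Qed.

(** The order by order cancellation: the terms of order [delta] and the
    oscillating term [A] of order [delta ^+ 2] drop out, and [H] remains.
    The integral [I] is known up to the remainder of its expansion. *)
Lemma bracket_estimate (K N B M Cz CV eta delta eps s r f2 D a1 a c tha thc
    G J A H I z0 : R) :
  0 < delta <= eta -> 0 < eps <= eta -> eta <= 1 ->
  0 <= M -> 0 <= Cz -> 0 <= CV ->
  `|s| <= K -> `|s * r| <= N -> `|f2| <= N -> `|D| <= N ->
  `|a1| <= B -> `|a| <= B -> `|tha| <= eta -> `|thc| <= eta ->
  `|J - delta ^+ 2 * G| <= eta * delta ^+ 2 ->
  z0 = s * r + delta * f2 ->
  A = s * a + s ^+ 2 / 2 * c + s ^+ 2 * (a1 * r) + G ->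
  `|I - ((s + delta * (s * z0 + eps * D)) * (delta * a1 + delta ^+ 2 * (a + tha)) +
      s ^+ 2 / 2 * (delta ^+ 2 * (c + thc)) + J)| <=
    (M * eps + delta * Cz) * (CV * delta ^+ 2) ->
  `|delta * (s * (0 - a1)) + delta ^+ 2 * (H - A) + I - delta ^+ 2 * H| <=
  delta ^+ 2 * (((M + Cz) * CV + (K + K ^+ 2) + (K * N + N) * B +
     (2 * (K * N) + N) * (B + 1) + 1) * eta).
Proof.
move=> /andP[d0 dn] /andP[e0 en] n1 M0 Cz0 CV0 sK srN f2N DN a1B aB thaE thcE JE z0E AE.
set X := (X in `|I - X| <= _) => IE.
have n0 : 0 < eta by exact: lt_le_trans dn.
have d2 : 0 <= delta ^+ 2 by exact: sqr_ge0.
have K0 : 0 <= K by exact: le_trans sK.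
have N0 : 0 <= N by exact: le_trans f2N.
have B0 : 0 <= B by exact: le_trans aB.
have dn' : `|delta| <= eta by rewrite gtr0_norm.
have en' : `|eps| <= eta by rewrite gtr0_norm.
have -> : delta * (s * (0 - a1)) + delta ^+ 2 * (H - A) + I - delta ^+ 2 * H =
  (I - X) + (J - delta ^+ 2 * G) +
  delta ^+ 2 * (s * tha + s ^+ 2 / 2 * thc + (s * (delta * f2) + eps * D) * a1 +
    delta * ((s * (s * r) + s * (delta * f2) + eps * D) * (a + tha))).
  by rewrite /X AE z0E; field.
have s2 : `|s ^+ 2 / 2| <= K ^+ 2.
  rewrite ger0_norm ?divr_ge0 ?sqr_ge0// -(@real_normK _ s) ?num_real//.
  have : `|s| ^+ 2 <= K ^+ 2 by rewrite lerXn2r ?nnegrE.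
  have := sqr_ge0 `|s|; lra.
have df : `|delta * f2| <= eta * N by exact: normM_le.
have t1 : `|s * tha| <= K * eta by exact: normM_le.
have t2 : `|s ^+ 2 / 2 * thc| <= K ^+ 2 * eta by exact: normM_le.
have t3 : `|(s * (delta * f2) + eps * D) * a1| <= (K * (eta * N) + eta * N) * B.
  by apply: normM_le => //; apply: normD_le; exact: normM_le.
have etaN : eta * N <= N by rewrite ler_piMl.
have t4 : `|delta * ((s * (s * r) + s * (delta * f2) + eps * D) * (a + tha))| <=
    eta * ((K * N + K * N + N) * (B + 1)).
  apply: normM_le => //; apply: normM_le; last first.
    by apply: normD_le => //; exact: le_trans thaE n1.
  apply: normD_le; last first.
    by apply: le_trans etaN; exact: normM_le.
  apply: normD_le; first exact: normM_le.
  by apply: normM_le => //; exact: le_trans df etaN.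
have t5 : (M * eps + delta * Cz) * (CV * delta ^+ 2) <=
    (M + Cz) * eta * (CV * delta ^+ 2).
  apply: ler_wpM2r; first exact: mulr_ge0.
  by rewrite [leRHS]mulrDl lerD ?ler_wpM2l// [leLHS]mulrC ler_wpM2l.
apply: le_trans (normD_le (normD_le (le_trans IE t5) JE) (normM_le (lexx `|delta ^+ 2|)
  (normD_le (normD_le (normD_le t1 t2) t3) t4))) _.
by rewrite ger0_norm// le_eqVlt; apply/orP; left; apply/eqP; ring.
Qed.

(** The normalization [W] and the ratio [delta / eps] only contribute a factor
    close to [1]. *)
Lemma ratio_estimate (N L eta delta eps W T H : R) :
  0 < delta <= eta -> 0 < eps <= eta -> eta <= 1 -> 0 <= L -> 0 <= N ->
  eta * N <= 2^-1 -> `|eps^-1 * delta - 1| <= eta -> `|W - 1| <= delta * N ->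
  `|T - delta ^+ 2 * H| <= delta ^+ 2 * (L * eta) ->
  `|eps ^- 2 * W^-1 * T - H| <= ((6 + 2 * N) * `|H| + 8 * L) * eta.
Proof.
move=> /andP[d0 dn] /andP[e0 en] n1 L0 N0 nN kE WE TE.
have n0 : 0 < eta by exact: lt_le_trans dn.
pose k := eps^-1 * delta; rewrite -/k in kE.
have WE' : `|W - 1| <= eta * N by apply: le_trans WE _; rewrite ler_wpM2r.
have W2 : 2^-1 <= W by move: WE'; rewrite ler_norml => /andP[]; lra.
have W0 : 0 < W by lra.
have d20 : 0 < delta ^+ 2 by rewrite exprn_gt0.
pose rho := (T - delta ^+ 2 * H) / delta ^+ 2.
have rhoE : `|rho| <= L * eta.
  by rewrite /rho normrM normfV (gtr0_norm d20) ler_pdivrMr// [leRHS]mulrC.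
have kk : `|k ^+ 2 - 1| <= 3 * eta.
  have -> : k ^+ 2 - 1 = (k - 1) * (k - 1 + 2) by ring.
  rewrite normrM mulrC; apply: ler_pM => //.
  by apply: le_trans (ler_normD _ _) _; rewrite (ger0_norm (ler0n _ 2)); lra.
have k4 : k ^+ 2 <= 4 by move: kk; rewrite ler_norml => /andP[]; lra.
have Wi : W^-1 <= 2 by rewrite invf_ple ?posrE//; lra.
have Wi0 : 0 <= W^-1 by rewrite invr_ge0 ltW.
have -> : eps ^- 2 * W^-1 * T - H =
    (k ^+ 2 - 1 - (W - 1)) * W^-1 * H + k ^+ 2 * W^-1 * rho.
  by rewrite /k /rho; field; rewrite ?gt_eqF.
apply: le_trans (ler_normD _ _) _; rewrite [leRHS]mulrDl; apply: lerD.
  rewrite normrM mulrAC ler_wpM2r// normrM (ger0_norm Wi0).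
  have -> : (6 + 2 * N) * eta = (3 * eta + eta * N) * 2 by ring.
  apply: ler_pM => //; apply: le_trans (ler_normB _ _) _; exact: lerD.
rewrite normrM -mulrA; apply: ler_pM => //.
rewrite normrM (ger0_norm (sqr_ge0 k)) (ger0_norm Wi0).
have -> : 8 = 4 * 2 :> R by ring.
by apply: ler_pM; rewrite ?sqr_ge0.
Qed.

End estimates.

Section symbol.
Context (R : realType) (d : measure_display) (E : measurableType d).
Variables (Gam0 : R.-ker E ~> R) (a b c : E -> R).
Hypothesis qexp0 : forall p : R, exists2 C, 0 <= C &
  forall x, (\int[Gam0 x]_v (qexp p v)%:E <= C%:E)%E.
Hypotheses (ba : bounded_measurable a) (bb : bounded_measurable b)
  (bc : bounded_measurable c).

(** The term of order [delta ^+ 2] of the generator before averaging, as a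
    function of the slope [s] of the test function, and its derivative. *)
Definition symbol (s : R) (x : E) : R :=
  s * a x + s ^+ 2 / 2 * c x + s ^+ 2 * b x + levy_exponent Gam0 s x.

Definition symbol_deriv (s : R) (x : E) : R :=
  a x + s * c x + 2 * s * b x + levy_exponent_deriv Gam0 s x.

Lemma bounded_symbol s : bounded_measurable (symbol s).
Proof.
apply: bounded_measurableD; last exact: bounded_levy_exponent.
by do 2?[apply: bounded_measurableD]; exact: bounded_measurableZ.
Qed.

Lemma bounded_symbol_deriv s : bounded_measurable (symbol_deriv s).
Proof.
apply: bounded_measurableD; last exact: bounded_levy_exponent_deriv.
apply: bounded_measurableD; last exact: bounded_measurableZ.
by apply: bounded_measurableD => //; exact: bounded_measurableZ.
Qed.

Lemma symbol_expansion (K : R) : 0 <= K -> exists C,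
  (forall s x, `|s| <= K -> `|symbol s x| <= C /\ `|symbol_deriv s x| <= C) /\
  (forall s t x, `|s| <= K -> `|t| <= K ->
     `|symbol t x - symbol s x - (t - s) * symbol_deriv s x| <= C * (t - s) ^+ 2).
Proof.
move=> K0.
have [_ [A hA]] := ba; have [_ [B hB]] := bb; have [_ [C hC]] := bc.
have A0 : 0 <= A by exact: le_trans (hA point).
have B0 : 0 <= B by exact: le_trans (hB point).
have C0 : 0 <= C by exact: le_trans (hC point).
have [G G0 [hG1 hG2]] := levy_exponent_expansion qexp0 K0.
have K20 : 0 <= K ^+ 2 by exact: sqr_ge0.
have KA : 0 <= K * A by exact: mulr_ge0.
have KB : 0 <= K * B by exact: mulr_ge0.
have KC : 0 <= K * C by exact: mulr_ge0.
have K2C : 0 <= K ^+ 2 * C by exact: mulr_ge0.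
have K2B : 0 <= K ^+ 2 * B by exact: mulr_ge0.
exists (A + B + C + K * A + K ^+ 2 * C + K ^+ 2 * B + K * C + 2 * (K * B) + G).
split=> [s x sK|s t x sK tK].
  have [g1 g2] := hG1 s x sK.
  have s2 : `|s ^+ 2| <= K ^+ 2 by rewrite normrX lerXn2r ?nnegrE.
  have s22 : `|s ^+ 2 / 2| <= K ^+ 2.
    by rewrite normf_div (ger0_norm (ler0n _ 2)); have := normr_ge0 (s ^+ 2); lra.
  have m (k f X Y : R) : `|k| <= X -> `|f| <= Y -> `|k * f| <= X * Y.
    by move=> kX fY; rewrite normrM ler_pM.
  split.
    have h1 := m _ _ _ _ sK (hA x); have h2 := m _ _ _ _ s22 (hC x).
    have h3 := m _ _ _ _ s2 (hB x).
    apply: le_trans (ler_normD _ _) _; apply: le_trans (lerD (ler_normD _ _) g1) _.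
    apply: le_trans (lerD (lerD (ler_normD _ _) h3) (lexx G)) _.
    apply: le_trans (lerD (lerD (lerD h1 h2) (lexx _)) (lexx G)) _; lra.
  have h2 := m _ _ _ _ sK (hC x).
  have h3 : `|2 * s * b x| <= 2 * K * B.
    by apply: m => //; rewrite normrM (ger0_norm (ler0n _ 2)); lra.
  apply: le_trans (ler_normD _ _) _; apply: le_trans (lerD (ler_normD _ _) g2) _.
  apply: le_trans (lerD (lerD (ler_normD _ _) h3) (lexx G)) _.
  apply: le_trans (lerD (lerD (lerD (hA x) h2) (lexx _)) (lexx G)) _; lra.
have hg := hG2 s t x sK tK.
have -> : symbol t x - symbol s x - (t - s) * symbol_deriv s x =
   (t - s) ^+ 2 * (c x / 2 + b x) + (levy_exponent Gam0 t x - levy_exponent Gam0 s x -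
     (t - s) * levy_exponent_deriv Gam0 s x).
  by rewrite /symbol /symbol_deriv; field.
apply: le_trans (ler_normD _ _) _; apply: le_trans (lerD (lexx _) hg) _.
rewrite normrM (ger0_norm (sqr_ge0 _)) mulrC -mulrDl ler_wpM2r ?sqr_ge0//.
suff : `|c x / 2 + b x| <= B + C by lra.
apply: le_trans (ler_normD _ _) _.
rewrite normf_div (ger0_norm (ler0n _ 2)); have := hC x; have := hB x.
have := normr_ge0 (c x); lra.
Qed.

End symbol.

Section averaged_symbol.
Context (R : realType) (d : measure_display) (E : measurableType d).
Variables (Gam0 : R.-ker E ~> R) (pi : probability E R) (R0 : (E -> R) -> E -> R).
Variables (a1 a c : E -> R).
Hypothesis qexp0 : forall p : R, exists2 C, 0 <= C &
  forall x, (\int[Gam0 x]_v (qexp p v)%:E <= C%:E)%E.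
Hypothesis hfirst : first_moment_limit Gam0 pi.
Hypotheses (ba : bounded_measurable a) (bc : bounded_measurable c).
Hypothesis bb : bounded_measurable (fun x => a1 x * R0 a1 x).

(** The stationary average of the symbol is the limit exponential generator. *)
Lemma Pi_symbol (phi : R -> R) u :
  Pi pi (symbol Gam0 a (fun x => a1 x * R0 a1 x) c (derive1 phi u)) =
  H0 Gam0 pi R0 a1 a c phi u.
Proof.
rewrite /H0 (Rintegral_levy_exponent qexp0 hfirst) /sigma2 /Pi /symbol.
set s := derive1 phi u.
have pi1 : pi [set: E] = 1%E by exact: probability_setT.
have int f : bounded_measurable f -> pi.-integrable [set: E] (EFin \o f).
  exact: bounded_measurable_integrable.
have bsa := bounded_measurableZ s ba.
have bsc := bounded_measurableZ (s ^+ 2 / 2) bc.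
have bsb := bounded_measurableZ (s ^+ 2) bb.
have bl := bounded_levy_exponent qexp0 s.
rewrite RintegralD//; [|apply: int|exact: int]; last first.
  by apply: bounded_measurableD => //; exact: bounded_measurableD.
rewrite RintegralD//; [|apply: int|exact: int]; last exact: bounded_measurableD.
rewrite RintegralD//; [|exact: int|exact: int].
rewrite !RintegralZl//; [|exact: int|exact: int|exact: int].
by field.
Qed.

End averaged_symbol.

Theorem theorem1 (R : realType) (d : measure_display) (E : measurableType d)
  (q : E -> R) (P : R.-pker E ~> E) (Pt : R -> R.-pker E ~> E)
  (pi : probability E R) (R0 : (E -> R) -> E -> R)
  (Gam : R -> R.-ker E ~> R) (Gam0 : R.-ker E ~> R) (a1 a c : E -> R)
  (hswitch : ergodic_switching q P Pt pi R0)
  (hmean : mean_approximation Gam a1 a c)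
  (hintensity : intensity_representation Gam Gam0)
  (hbalance : balance pi a1)
  (husi : uniform_square_integrability Gam0)
  (hexp : exponential_finiteness Gam)
  (huexp : uniform_exponential_finiteness Gam)
  (hfirst : first_moment_limit Gam0 pi)
  (phi : R -> R) (hphi : C3_smooth phi) :
  exists phi1 phi2 : R -> E -> R,
    [/\ admissible_perturbation phi1,
        admissible_perturbation phi2 &
        forall u : R,
          supnorm (fun x =>
            exponential_generator Gam q P p.1 p.2
              (perturbed phi phi1 phi2 p.1 p.2) u x
            - H0 Gam0 pi R0 a1 a c phi u)
          @[p --> levy_scaling R] --> 0%E].
Proof.
pose x0 : E := point.
have pot := switching_potential hswitch.
have [R0bm _ _ QR0 _] := pot.
have [ba1 ba bc [tha [thc [na nc hm]]]] := hmean.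
have qexp0 := Gam0_qexp_le x0 hmean hintensity hexp huexp.
pose r := R0 a1; have br : bounded_measurable r by exact: R0bm.
have bb : bounded_measurable (fun x => a1 x * r x) by exact: bounded_measurableM.
pose A := symbol Gam0 a (fun x => a1 x * r x) c.
have bA s : bounded_measurable (A s) by exact: bounded_symbol.
pose A' := symbol_deriv Gam0 a (fun x => a1 x * r x) c.
have bA' s : bounded_measurable (A' s) by exact: bounded_symbol_deriv.
have [K K0 [phiL phiT [psiK dpsiK psiL psiT]]] := C3_smooth_bounds hphi.
pose psi := derive1 phi; pose dpsi := derive1 psi.
(* the first corrector cancels the oscillating drift of order delta, the
   second one the oscillation of the symbol *)
pose phi1 u x := psi u * r x.
pose phi2 u x := R0 (A (psi u)) x.
have [B1 hB1] := br.2.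
have B10 : 0 <= B1 by exact: le_trans (hB1 x0).
have [M1 [D1 C1]] : exists M D, unif_C11 phi1 D M.
  have KB : 0 <= K * B1 by exact: mulr_ge0.
  exists (K * B1 + B1 + K * (K * B1 + B1) + (K * B1 + B1) * K ^+ 2).
  exists (fun u x => dpsi u * r x).
  apply: (@unif_C11_comp _ _ (fun s x => s * r x) (fun=> r)) => //.
  - exact: addr_ge0.
  - move=> s x sK; split; last by have := hB1 x; lra.
    have : `|s * r x| <= K * B1 by rewrite normrM ler_pM.
    lra.
  - move=> s t x _ _; rewrite (_ : _ - _ - _ = 0); last by ring.
    by rewrite normr0 mulr_ge0 ?sqr_ge0 ?addr_ge0.
have [M2 [D2 C2]] : exists M D, unif_C11 phi2 D M.
  have [C [hC1 hC2]] := symbol_expansion qexp0 ba bb bc K0.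
  have [C' C'0 [hC'1 hC'2]] := potential_expansion pot bA bA' hC1 hC2.
  by do 2 eexists; exact: (unif_C11_comp C'0 hC'1 hC'2 psiK dpsiK psiL psiT).
exists phi1, phi2; split.
- split; first by exists M1 => u x; have [] := C1 u x.
  + by move=> u; exact: (bounded_measurableZ (psi u) br).1.
  + by move=> x; apply: continuous_measurable_fun; exact: (unif_C11_continuous C1).
- split; first by exists M2 => u x; have [] := C2 u x.
  + by move=> u; exact: (R0bm _ (bA _)).1.
  + by move=> x; apply: continuous_measurable_fun; exact: (unif_C11_continuous C2).
move=> u; apply/(supnorm_cvg0P _ _ x0) => e e0.
have M10 : 0 <= M1 by have [+ _ _] := C1 0 x0; exact: le_trans.
have M20 : 0 <= M2 by have [+ _ _] := C2 0 x0; exact: le_trans.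
pose N := K + M1 + M2; have N0 : 0 <= N by rewrite !addr_ge0.
have [Ba1 hBa1] := ba1.2; have [Ba hBa] := ba.2.
pose B := Ba1 + Ba.
have Ba10 : 0 <= Ba1 by exact: le_trans (hBa1 x0).
have Ba0 : 0 <= Ba by exact: le_trans (hBa x0).
have [CV CV0 hCV] := Gam_qexp_le x0 hmean hexp huexp K.
have [CV' _ hCV'] := Gam_qexp_le x0 hmean hexp huexp (K + 1).
pose Cz := N * (K ^+ 2 + N) + 2 * K * N + N.
have Cz0 : 0 <= Cz.
  by rewrite /Cz addr_ge0// addr_ge0 ?mulr_ge0// addr_ge0 ?sqr_ge0.
pose L := (N + Cz) * CV + (K + K ^+ 2) + (K * N + N) * B +
     (2 * (K * N) + N) * (B + 1) + 1.
have L0 : 0 <= L.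
  have KN : 0 <= K * N by exact: mulr_ge0.
  have B0 : 0 <= B by exact: addr_ge0.
  have := mulr_ge0 (addr_ge0 N0 Cz0) CV0; have := mulr_ge0 (addr_ge0 KN N0) B0.
  have : 0 <= (2 * (K * N) + N) * (B + 1).
    by apply: mulr_ge0; [lra|exact: addr_ge0].
  by have := sqr_ge0 K; rewrite /L; lra.
set H := H0 _ _ _ _ _ _ _ _.
pose L' := (6 + 2 * N) * `|H| + 8 * L.
have L'0 : 0 <= L'.
  by have := mulr_ge0 N0 (normr_ge0 H); have := normr_ge0 H; rewrite /L'; lra.
(* all the small quantities are taken below eta: the second bound keeps W away
   from 0, the third one makes the final error L' * eta at most e *)
pose eta := Num.min 1 (Num.min (2 * N + 2)^-1 (e / (L' + 1))).
have eta0 : 0 < eta.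
  by rewrite !lt_min ltr01 invr_gt0 divr_gt0//=; lra.
have eta1 : eta <= 1 by rewrite ge_min lexx.
have etaN : eta * N <= 2^-1.
  have : eta <= (2 * N + 2)^-1 by rewrite !ge_min lexx orbT.
  rewrite -[X in _ <= X -> _]div1r ler_pdivlMr; last by lra.
  lra.
have etaL : L' * eta <= e.
  have : eta <= e / (L' + 1) by rewrite !ge_min lexx !orbT.
  by rewrite ler_pdivlMr; lra.
have gE : forall v, `|levy_rem (psi u) v| <= K ^+ 3 * (`|v| ^+ 3 * expR (K * `|v|)).
  by move=> v; exact: norm_levy_rem_le.
have nG := levy_scaling_delta (Gam_cvg_exp_growth x0 hmean hintensity hexp huexp
  (exprn_ge0 3 K0) (@continuous_levy_rem R (psi u)) gE eta0).
have nta := levy_scaling_delta (negligible_termP x0 na eta0).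
have ntc := levy_scaling_delta (negligible_termP x0 nc eta0).
have nV := levy_scaling_delta hCV; have nV' := levy_scaling_delta hCV'.
have ns := levy_scaling_small eta0.
near=> p => x.
have [/[dup] hd /andP[d0 d1] /[dup] he /andP[e1 e2] hk] :
    [/\ 0 < p.2 <= eta, 0 < p.1 <= eta & `|p.1^-1 * p.2 - 1| <= eta].
  by have [] : [/\ 0 < p.1 <= eta, 0 < p.2 <= eta & `|p.1^-1 * p.2 - 1| <= eta]
    by near: p.
have hV : (\int[Gam p.2 x]_v (qexp K v)%:E <= (CV * p.2 ^+ 2)%:E)%E.
  by move: (x); near: p.
have hV' : (\int[Gam p.2 x]_v (qexp (K + 1) v)%:E <= (CV' * p.2 ^+ 2)%:E)%E.
  by move: (x); near: p.
have hta : `|tha p.2 x| <= eta by move: (x); near: p.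
have htc : `|thc p.2 x| <= eta by move: (x); near: p.
have hJ : `|\int[Gam p.2 x]_v levy_rem (psi u) v -
    p.2 ^+ 2 * \int[Gam0 x]_v levy_rem (psi u) v| <= eta * p.2 ^+ 2.
  by move: (x); near: p.
move: (p.1) (p.2) hd he d0 d1 e1 e2 hk hV hV' hta htc hJ => eps delta hd he d0 d1
  e1 e2 hk hV hV' hta htc hJ.
have [m1 m2] := hm delta x d0.
have dle1 : 0 <= delta <= 1 by rewrite ltW//= (le_trans d1).
have Cz12 : unif_C11 (fun u x => phi1 u x + delta * phi2 u x)
    (fun u x => D1 u x + delta * D2 u x) N.
  by apply: (unif_C11D _ _ C1 C2) => //; rewrite /N; lra.
pose W u x := 1 + delta * phi1 u x + delta ^+ 2 * phi2 u x.
have WE u' x' : W u' x' = 1 + delta * (phi1 u' x' + delta * phi2 u' x').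
  by rewrite /W; ring.
have WN u' x' : `|W u' x' - 1| <= delta * N.
  rewrite WE addrAC subrr add0r normrM gtr0_norm// ler_pM2l//.
  by have [] := Cz12 u' x'.
have W0 u' x' : 0 < W u' x'.
  have : delta * N <= eta * N by exact: ler_wpM2r.
  by have := WN u' x'; rewrite ler_norml => /andP[+ _]; lra.
pose y v := (phi (u + eps * v) - phi u) / eps.
pose z v := phi1 (u + eps * v) x + delta * phi2 (u + eps * v) x.
pose z0 := phi1 u x + delta * phi2 u x.
have een : eps != 0 by rewrite gt_eqF.
have maff : measurable_fun [set: R] (fun v : R => u + eps * v).
  by apply: measurable_funD => //; exact: measurable_funM.
have mphi : measurable_fun [set: R] phi.
  by apply: continuous_measurable_fun; have [_ /(_ 0 isT)[]] := hphi.
have my : measurable_fun [set: R] y.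
  apply: measurable_funM => //; apply: measurable_funB => //.
  exact: (measurableT_comp mphi maff).
have mz : measurable_fun [set: R] z.
  have mf : measurable_fun [set: R] (fun t => phi1 t x + delta * phi2 t x).
    apply: continuous_measurable_fun.
    exact: (unif_C11_continuous Cz12 (x := x)).
  exact: (measurableT_comp mf maff).
have yK v : `|y v| <= K * `|v|.
  rewrite normrM normfV (gtr0_norm e1) ler_pdivrMr//.
  apply: le_trans (phiL _ _) _; rewrite normrM (gtr0_norm e1).
  by rewrite le_eqVlt; apply/orP; left; apply/eqP; ring.
have ys v : `|y v - v * psi u| <= N * eps * v ^+ 2.
  have -> : y v - v * psi u = (phi (u + eps * v) - phi u - eps * v * psi u) / eps.
    by rewrite /y; field.
  rewrite normrM normfV (gtr0_norm e1) ler_pdivrMr//.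
  apply: le_trans (phiT _ _) _.
  have -> : N * eps * v ^+ 2 * eps = N * (eps * v) ^+ 2 by ring.
  by rewrite ler_wpM2r ?sqr_ge0// /N; lra.
have zM v : `|z v| <= N by have [] := Cz12 (u + eps * v) x.
have zz v : `|z v - z0| <= 2 * N * (eps * `|v|).
  have := unif_C11_lipschitz Cz12 u (eps * v) x.
  by rewrite normrM (gtr0_norm e1).
have zD v : `|z v - z0 - eps * v * (D1 u x + delta * D2 u x)| <= N * (eps * v) ^+ 2.
  by have [_ _] := Cz12 u x; exact.
have eps1 : eps <= 1 by exact: le_trans eta1.
have jE := jump_integral_expansion K0 e1 eps1 N0 (ltW d0) (psiK u) hV hV'
  (Gam_id_integrable hexp x d0) (Gam_sqr_integrable hexp x d0) my mz yK ys zM zz zD.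
have jI := jump_integrable K0 e1 eps1 N0 (ltW d0) (psiK u) hV hV'
  (Gam_id_integrable hexp x d0) (Gam_sqr_integrable hexp x d0) my mz yK ys zM zz zD.
have jumpE : (fun v => expR (y v) * (1 + delta * z v) - (1 + delta * z0)) =
    (fun v => expR ((phi (u + eps * v) - phi u) / eps) * W (u + eps * v) x - W u x).
  by apply/funext => v; rewrite !WE.
rewrite jumpE in jI jE.
have b1 : bounded_measurable (phi1 u) by exact: bounded_measurableZ.
have b2 : bounded_measurable (phi2 u) by exact: R0bm.
rewrite (@exponential_generatorE R d E Gam q P phi phi1 phi2 eps delta u x e1 W0
  b1 b2 jI).
have Q1 : switchQ q P (phi1 u) x = psi u * (0 - a1 x).
  have -> : phi1 u = (fun y => 0 + psi u * r y + 0 * r y).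
    by apply/funext => t; rewrite /phi1 add0r mul0r addr0.
  rewrite switchQ_linear// QR0//= /Pi hbalance; ring.
have Q2 : switchQ q P (phi2 u) x = H - A (psi u) x.
  by rewrite QR0//= Pi_symbol.
rewrite Q1 Q2 m1 m2 in jE *.
have z0x : z0 = psi u * r x + delta * phi2 u x by [].
have [_ DN _] := Cz12 u x.
have f1N : `|psi u * r x| <= N.
  by have [h _ _] := C1 u x; apply: le_trans h _; rewrite /N; lra.
have f2N : `|phi2 u x| <= N.
  by have [h _ _] := C2 u x; apply: le_trans h _; rewrite /N; lra.
have a1B : `|a1 x| <= B by apply: le_trans (hBa1 x) _; rewrite /B; lra.
have aB : `|a x| <= B by apply: le_trans (hBa x) _; rewrite /B; lra.
have := bracket_estimate H hd he eta1 N0 Cz0 CV0 (psiK u) f1N f2N DN a1B aB hta htc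
  hJ z0x (erefl : A (psi u) x = _) jE.
move=> bE; apply: le_trans etaL.
exact: (ratio_estimate hd he eta1 L0 N0 etaN hk (WN u x) bE).
Unshelve. all: by end_near. Qed.
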